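(* Let $0\le\gamma<1$, $\alpha=\frac{4}{3+\gamma}$, let $\Omega\subset\mathbb{R}^n$ be a bounded smooth domain and $\varphi\ge0$ a smooth boundary datum, and let $u$ be a limit Perron's solution of the problem $$\Delta_\infty u=u^{-\gamma}\ \text{ in }\Omega\cap\{u>0\},\qquad u=\varphi\ \text{ on }\partial\Omega .$$ Given a subdomain $\Omega'\Subset\Omega$, there exists a positive constant $c_\star$, depending only on $\gamma$, $\|u\|_{L^\infty(\Omega)}$, $\mathrm{dist}(\Omega',\partial\Omega)$ and the dimension $n$, such that for every $x\in\Omega'\cap\{u>0\}$ and $0<\kappa<\mathrm{dist}(\Omega',\partial\Omega)$ there holds $$\frac{\mathcal{L}^n\left(B_\kappa(x)\cap\{u>0\}\right)}{\mathcal{L}^n\left(B_\kappa(x)\right)}\ge c_\star ,$$ where $\mathcal{L}^n$ is the $n$-dimensional Lebesgue measure.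
   Context: $\Delta_\infty u=\sum_{i,j}D_{ij}u\,D_iu\,D_ju$, understood in the viscosity sense. Fix $\delta=\frac12\alpha^{-4/(3+\gamma)}$ and a Lipschitz function $\mathcal{B}:\mathbb{R}\to\mathbb{R}$ with $0\le\mathcal{B}\le1$, $\mathcal{B}(s)=0$ for $s\le\delta/2$ and $\mathcal{B}(s)=1$ for $s\ge\delta$. For $\varepsilon>0$ put $\mathcal{B}_\varepsilon(s)=\mathcal{B}(s/\varepsilon^\alpha)$; the expression $\mathcal{B}_\varepsilon(s)s^{-\gamma}$ is taken to be $0$ for $s\le\frac{\delta}{2}\varepsilon^\alpha$. The penalized problem $(P_\varepsilon)$ is $$\Delta_\infty u=\mathcal{B}_\varepsilon(u)\,u^{-\gamma}\ \text{ in }\Omega,\qquad u=\varphi\ \text{ on }\partial\Omega .$$ Let $\underline u,\overline u\in C(\overline\Omega)$ be the viscosity solutions of $\Delta_\infty\underline u=(\delta/2)^{-\gamma}\varepsilon^{-\alpha\gamma}$ and $\Delta_\infty\overline u=0$ in $\Omega$ with $\underline u=\overline u=\varphi$ on $\partial\Omega$. The minimal (Perron) solution of $(P_\varepsilon)$ is $$u_\varepsilon(x)=\inf\{w(x): w\in C(\overline\Omega)\text{ is a viscosity supersolution of }(P_\varepsilon),\ \underline u\le w\le\overline u\text{ in }\overline\Omega\},$$ where a viscosity supersolution satisfies $\Delta_\infty w\le\mathcal{B}_\varepsilon(w)w^{-\gamma}$ in the viscosity sense; $u_\varepsilon$ is a nonnegative continuous viscosity solution of $(P_\varepsilon)$.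 A limit Perron's solution is a function $u$ on $\Omega$ that is the limit, uniformly on compact subsets of $\Omega$, of minimal solutions $u_{\varepsilon_k}$ for some sequence $\varepsilon_k\to0^+$. *)

(* Defs.v *)
From HB Require Import structures.
From mathcomp Require Import all_boot all_order all_algebra.
From mathcomp Require Import all_classical all_reals all_analysis.

Set Implicit Arguments.
Unset Strict Implicit.
Unset Printing Implicit Defensive.
Import Order.TTheory GRing.Theory Num.Theory.
Import numFieldNormedType.Exports.

Local Open Scope classical_set_scope.
Local Open Scope ring_scope.

Section Euclidean.
Context {R : realType} {n : nat}.
Implicit Types (x y : 'rV[R]_n) (A B : set 'rV[R]_n).

(* The library's norm on 'rV[R]_n is the sup norm.  It induces the usual
   topology, but balls and distances have to be Euclidean. *)
Definition enorm x : R := Num.sqrt (\sum_(i < n) x ord0 i ^+ 2).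

Definition eball x (r : R) : set 'rV[R]_n := [set y | enorm (y - x) < r].

Definition setdist A B : R :=
  inf [set r | exists x y, [/\ A x, B y & r = enorm (x - y)]].

Definition boundary A : set 'rV[R]_n := closure A `\` interior A.

Definition domain A : Prop := [/\ open A, connected A & A !=set0].

Definition compactly_contained A B : Prop :=
  compact (closure A) /\ closure A `<=` B.

Definition box (a b : 'rV[R]_n) : set 'rV[R]_n :=
  [set x | forall i, a ord0 i <= x ord0 i <= b ord0 i].

Definition box_volume (a b : 'rV[R]_n) : R :=
  \prod_(i < n) (b ord0 i - a ord0 i).

(* The n-dimensional Lebesgue outer measure, which coincides with the Lebesgue
   measure on measurable sets; it is only evaluated on sets that are open as
   soon as the functions involved are continuous. *)
Definition lebesgue_n A : \bar R :=
  ereal_inf [set s | exists a b : nat -> 'rV[R]_n,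
    [/\ forall k i, a k ord0 i <= b k ord0 i,
        A `<=` \bigcup_k box (a k) (b k) &
        s = (\sum_(0 <= k <oo) (box_volume (a k) (b k))%:E)%E]].

(* The essential supremum of `|u| over A. *)
Definition Linfty_norm A (u : 'rV[R]_n -> R) : \bar R :=
  ereal_inf [set M : \bar R | (0 <= M)%E /\
    lebesgue_n (A `&` [set x | (M < `|u x|%:E)%E]) = 0%E].

End Euclidean.

Section Differentiability.
Context {R : realType} {n : nat}.
Implicit Types (f u w : 'rV[R]_n -> R) (x p : 'rV[R]_n) (A Om : set 'rV[R]_n).

Definition partial (s : seq 'I_n) f : 'rV[R]_n -> R :=
  foldr (fun i g => 'D_('e_i) g) f s.

(* Intended for open A: all partial derivatives of order at most k exist and
   are continuous at the points of A. *)
Definition Ck (k : nat) A f : Prop :=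
  forall (s : seq 'I_n) x, A x -> (size s <= k)%N ->
    {for x, continuous (partial s f)} /\
    ((size s < k)%N -> forall i, derivable (partial s f) x 'e_i).

Definition smooth f : Prop := forall k, Ck k setT f.

(* Near each boundary point, Om is the negativity set of a smooth function
   whose gradient does not vanish at that point. *)
Definition smooth_boundary Om : Prop :=
  forall p, boundary Om p -> exists rho : 'rV[R]_n -> R,
    [/\ smooth rho,
        exists i, 'D_('e_i) rho p != 0 &
        \forall x \near p, Om x <-> rho x < 0].

Definition infty_laplacian f x : R :=
  \sum_(i < n) \sum_(j < n)
    partial [:: i; j] f x * partial [:: i] f x * partial [:: j] f x.

End Differentiability.

Section Viscosity.
Context {R : realType} {n : nat}.
Implicit Types (u w psi phi : 'rV[R]_n -> R) (Om : set 'rV[R]_n) (h : R -> R).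

(* Viscosity inequalities for infty_laplacian w = h w in Om, stated for
   functions w that are continuous on closure Om. *)
Definition visc_supersol Om h w : Prop :=
  forall psi x, Om x -> Ck 2 Om psi ->
    (\forall y \near x, w x - psi x <= w y - psi y) ->
    infty_laplacian psi x <= h (w x).

Definition visc_subsol Om h w : Prop :=
  forall psi x, Om x -> Ck 2 Om psi ->
    (\forall y \near x, w y - psi y <= w x - psi x) ->
    h (w x) <= infty_laplacian psi x.

Definition dirichlet_visc_sol Om h phi w : Prop :=
  [/\ {within closure Om, continuous w},
      visc_subsol Om h w,
      visc_supersol Om h w &
      forall x, boundary Om x -> w x = phi x].

End Viscosity.

Section Penalization.
Context {R : realType}.
Implicit Types (gamma eps : R) (beta : R -> R).

Definition alpha gamma : R := 4 / (3 + gamma).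

Definition delta gamma : R := 2^-1 * alpha gamma `^ (- (4 / (3 + gamma))).

Definition cutoff gamma beta : Prop :=
  [/\ [lipschitz beta s | s in [set: R]],
      forall s, 0 <= beta s <= 1,
      forall s, s <= delta gamma / 2 -> beta s = 0 &
      forall s, delta gamma <= s -> beta s = 1].

Definition penalty gamma beta eps (s : R) : R :=
  if s <= delta gamma / 2 * eps `^ alpha gamma then 0
  else beta (s / eps `^ alpha gamma) * s `^ (- gamma).

Context {n : nat}.
Implicit Types (phi v : 'rV[R]_n -> R) (Om : set 'rV[R]_n).

Definition minimal_solution Om gamma beta phi eps v : Prop :=
  exists ulow uupp : 'rV[R]_n -> R,
    [/\ dirichlet_visc_sol Om
          (fun=> (delta gamma / 2) `^ (- gamma)
                 * eps `^ (- (alpha gamma * gamma))) phi ulow,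
        dirichlet_visc_sol Om (fun=> 0) phi uupp &
        forall x, closure Om x ->
          v x = inf [set w x | w in [set w : 'rV[R]_n -> R |
            [/\ {within closure Om, continuous w},
                visc_supersol Om (penalty gamma beta eps) w &
                forall y, closure Om y -> ulow y <= w y <= uupp y]]]].

(* Only the values of u on Om matter. *)
Definition limit_perron_solution Om gamma beta phi (u : 'rV[R]_n -> R) : Prop :=
  exists (eps : nat -> R) (v : nat -> 'rV[R]_n -> R),
    [/\ forall k, 0 < eps k,
        eps @ \oo --> 0,
        forall k, minimal_solution Om gamma beta phi (eps k) (v k) &
        forall K, compact K -> K `<=` Om -> {uniform K, v @ \oo --> u}].

Definition positivity_set Om (u : 'rV[R]_n -> R) : set 'rV[R]_n :=
  Om `&` [set x | 0 < u x].

End Penalization.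

(* Main.v *)
Require Import Defs.
From mathcomp Require Import all_boot all_order all_algebra.
From mathcomp Require Import all_classical all_reals all_analysis.
From mathcomp Require Import finmap ring lra.
Import Order.TTheory GRing.Theory Num.Theory.
Import numFieldNormedType.Exports.
Local Open Scope classical_set_scope.
Local Open Scope ring_scope.

Set Implicit Arguments.
Unset Strict Implicit.
Unset Printing Implicit Defensive.

(* It is enough to find a ball of radius [c * kappa] inside the positivity set.

   Nondegeneracy: if a minimal solution were below [r ^ alpha / 4] on the sphere
   of radius [r] about [x], then the minimum of a competitor and of the bowl
   [s + r ^ (alpha - 2) |y - x| ^ 2 / 4], with [s = delta * eps ^ alpha], would be
   a competitor with value at most [s] at [x].  Hence in the limit [u] reaches
   [r ^ alpha / 8] at some point [p] of that sphere.

   Growth: for a nonnegative supersolution [w] of the penalized problem and a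
   small [tau > 0], the function [V = (w + tau) ^ (1 / alpha)] lies above every
   cone of slope larger than a constant depending only on [gamma].  This holds
   for all competitors, so it passes to their infimum and then to the limit:
   [u] is positive on a ball about [p] of radius proportional to [r].

   The constant depends only on [gamma] and [n]. *)

(** * Euclidean norm and balls *)

(** The relation 3 alpha - 4 = - alpha gamma drives both halves. It gives the bowl an infinity
    Laplacian of at most r ^ (- alpha gamma) / 8, which lies below the penalty term as long as the
    bowl stays between [s] and r ^ alpha. It also makes the inequality for [V] invariant under V ->
    t V(./t), so the critical slope does not see the size of [V] and no norm of [u] enters. A
    minimal solution is given only as a pointwise infimum, so smallness on a sphere must first be
    realised by a single competitor; compactness of the sphere does this. Test functions must be C^2
    on all of [Om], and the power of a cone is singular at the vertex; all tests are therefore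
    polynomials in the squared distance, whose derivatives are explicit. The shift [tau] keeps the
    base of the power positive where a competitor vanishes; it costs a factor 1/2 at the end. Since
    [lebesgue_n] is an infimum over covers by boxes, the lower bound for the volume of a ball rests
    on compactness and lattice counting. *)

Section EuclideanNorm.
Context {R : realType} {n : nat}.
Implicit Types x y z a : 'rV[R]_n.

Lemma enorm_ge0 x : 0 <= enorm x.
Proof. exact: sqrtr_ge0. Qed.

Lemma enorm_sqr x : enorm x ^+ 2 = \sum_(i < n) x ord0 i ^+ 2.
Proof. by rewrite sqr_sqrtr// sumr_ge0// => i _; exact: sqr_ge0. Qed.

Lemma enormN x : enorm (- x) = enorm x.
Proof.
by congr Num.sqrt; apply: eq_bigr => i _; rewrite mxE sqrrN.
Qed.

Lemma enorm_distC x y : enorm (x - y) = enorm (y - x).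
Proof. by rewrite -enormN opprB. Qed.

Lemma enorm0 : enorm (0 : 'rV[R]_n) = 0.
Proof. by rewrite /enorm big1 ?sqrtr0// => i _; rewrite mxE expr0n. Qed.

Lemma ler_coord_enorm x i : `|x ord0 i| <= enorm x.
Proof.
rewrite -sqrtr_sqr ler_wsqrtr// (bigD1 i)//= lerDl sumr_ge0// => j _.
exact: sqr_ge0.
Qed.

Lemma enorm_eq0 x : enorm x = 0 -> x = 0.
Proof.
move=> x0; apply/rowP => i; rewrite mxE; apply/eqP.
by rewrite -normr_le0 -x0 ler_coord_enorm.
Qed.

Lemma dot_le_enorm x y : \sum_(i < n) x ord0 i * y ord0 i <= enorm x * enorm y.
Proof.
have [x0|x0] := eqVneq (enorm x) 0.
  rewrite x0 mul0r big1// => i _.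
  by rewrite (enorm_eq0 x0) mxE mul0r.
have [y0|y0] := eqVneq (enorm y) 0.
  rewrite y0 mulr0 big1// => i _.
  by rewrite (enorm_eq0 y0) mxE mulr0.
have xy0 : 0 < enorm x * enorm y by rewrite mulr_gt0// lt_def ?x0 ?y0 enorm_ge0.
have : 0 <= \sum_(i < n) (enorm y * x ord0 i - enorm x * y ord0 i) ^+ 2.
  by rewrite sumr_ge0// => i _; exact: sqr_ge0.
have -> : \sum_(i < n) (enorm y * x ord0 i - enorm x * y ord0 i) ^+ 2 =
    enorm y ^+ 2 * enorm x ^+ 2 + enorm x ^+ 2 * enorm y ^+ 2
    - 2 * (enorm x * enorm y) * \sum_(i < n) x ord0 i * y ord0 i.
  rewrite [X in _ * X + _]enorm_sqr [X in _ + _ * X - _]enorm_sqr.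
  rewrite !mulr_sumr -sumrN -!big_split/=.
  by apply: eq_bigr => i _; ring.
move=> h; rewrite -(ler_pM2l xy0).
move: h; set S := \sum_(i < n) _ => h.
lra.
Qed.

Lemma ler_enormD x y : enorm (x + y) <= enorm x + enorm y.
Proof.
rewrite -(@ler_pXn2r _ 2)// ?nnegrE ?addr_ge0 ?enorm_ge0//.
have -> : enorm (x + y) ^+ 2 =
    enorm x ^+ 2 + enorm y ^+ 2 + (\sum_(i < n) x ord0 i * y ord0 i) *+ 2.
  rewrite !enorm_sqr -mulr_natr mulr_suml -!big_split/=.
  by apply: eq_bigr => i _; rewrite mxE; ring.
have := dot_le_enorm x y; nra.
Qed.

Lemma ler_enorm_dist y x z : enorm (x - z) <= enorm (x - y) + enorm (y - z).
Proof. by have := ler_enormD (x - y) (y - z); rewrite addrA subrK. Qed.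

Lemma enormZ (k : R) x : enorm (k *: x) = `|k| * enorm x.
Proof.
rewrite /enorm -sqrtr_sqr -sqrtrM ?sqr_ge0// mulr_sumr.
by congr Num.sqrt; apply: eq_bigr => i _; rewrite mxE exprMn.
Qed.

Lemma enorm_le_coord x (c : R) : (forall i, `|x ord0 i| <= c) ->
  enorm x <= n%:R * c.
Proof.
move=> xc; have [n0|n0] := posnP n.
  rewrite /enorm big1 ?sqrtr0; first by rewrite n0 mul0r.
  by move=> i; have := ltn_ord i; rewrite {2}n0.
have c0 : 0 <= c by apply: le_trans (xc (Ordinal n0)).
rewrite -(@ler_pXn2r _ 2)// ?nnegrE ?mulr_ge0 ?enorm_ge0//.
rewrite enorm_sqr (@le_trans _ _ (\sum_(i < n) c ^+ 2))//.
  apply: ler_sum => i _; rewrite -real_normK ?num_real//.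
  by rewrite ler_pXn2r// nnegrE.
rewrite sumr_const card_ord -(mulr_natl (c ^+ 2)) exprMn.
rewrite ler_wpM2r ?sqr_ge0// -natrX ler_nat.
by case: (n) n0 => // m _; rewrite expnS expn1 leq_pmulr.
Qed.

Lemma continuous_sqdist a :
  continuous (fun y : 'rV[R]_n => \sum_(i < n) (y ord0 i - a ord0 i) ^+ 2).
Proof.
apply: continuous_big => [|i _ y]; first exact: add_continuous.
apply: (@continuous_comp _ _ _ (fun y : 'rV_n => y ord0 i - a ord0 i) (@GRing.exp R ^~ 2)).
  by apply: continuousB; [exact: (@coord_continuous R 1 n ord0 i)|exact: cst_continuous].
exact: exprn_continuous.
Qed.

Lemma continuous_enorm_dist a : continuous (fun y : 'rV[R]_n => enorm (y - a)).
Proof.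
have -> : (fun y : 'rV[R]_n => enorm (y - a)) =
    @Num.sqrt R \o (fun y : 'rV[R]_n => \sum_(i < n) (y ord0 i - a ord0 i) ^+ 2).
  by apply/funext => y /=; congr Num.sqrt; apply: eq_bigr => i _; rewrite !mxE.
move=> y; apply: continuous_comp; first exact: continuous_sqdist.
exact: sqrt_continuous.
Qed.

Definition ceball a (r : R) : set 'rV[R]_n := [set y | enorm (y - a) <= r].

Lemma closed_ceball a r : closed (ceball a r).
Proof.
apply: (@preimage_closed _ _ (fun y => enorm (y - a)) [set t | t <= r]).
  by move=> y _; exact: continuous_enorm_dist.
exact: closed_le.
Qed.

Lemma open_eball a r : open (eball a r).
Proof.
apply: (@open_comp _ _ (fun y => enorm (y - a)) [set t | t < r]).
  by move=> y _; exact: continuous_enorm_dist.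
exact: open_lt.
Qed.

Lemma ler_coord_norm x i : `|x ord0 i| <= `|x|.
Proof.
by rewrite [leRHS]/Num.norm /= mx_normrE; apply/bigmax_geP; right => /=; exists (ord0, i).
Qed.

Lemma norm_le_coord x (c : R) : 0 <= c -> (forall i, `|x ord0 i| <= c) -> `|x| <= c.
Proof.
move=> c0 xc; rewrite [leLHS]/Num.norm /= mx_normrE; apply/bigmax_leP; split => //=.
by move=> [i j] _ /=; rewrite (ord1 i).
Qed.

Lemma norm_le_enorm x : `|x| <= enorm x.
Proof. by apply: norm_le_coord => [|i]; [exact: enorm_ge0|exact: ler_coord_enorm]. Qed.

Lemma compact_ceball a r : compact (ceball a r).
Proof.
apply: bounded_closed_compact; last exact: closed_ceball.
exists (`|a| + `|r|); split; first exact: num_real.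
move=> M rM y yar /=; rewrite -[X in `|X|](subrK a y) (le_trans (ler_normD _ _))//.
rewrite addrC (le_trans _ (ltW rM))// lerD2l (le_trans (norm_le_enorm _))//.
exact: le_trans yar (ler_norm r).
Qed.

Lemma compact_min_attained (f : 'rV[R]_n -> R) (A : set 'rV[R]_n) : compact A -> A !=set0 ->
  {within A, continuous f} -> exists2 y, A y & forall z, A z -> f y <= f z.
Proof.
move=> cA A0 cf; have [y yA ymin] := EVT_min_rV A0 cA cf.
by exists y => [|z zA]; [exact/set_mem|apply: ymin; exact/mem_set].
Qed.

(* The closest point of the complement of [Om] lies on the boundary. *)
Lemma eball_sub_open (Om : set 'rV[R]_n) x r : open Om -> Om x ->
  (forall z, boundary Om z -> r <= enorm (x - z)) -> eball x r `<=` Om.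
Proof.
move=> oOm Omx bOm y xyr; apply: contrapT => Omy.
have cK : compact (ceball x (enorm (y - x)) `&` ~` Om).
  by apply: compact_closedI; [exact: compact_ceball|exact: open_closedC].
have [||z [zr Omz] zmin] := @compact_min_attained (fun z => enorm (z - x)) _ cK.
- by exists y; split => //; rewrite /ceball/=.
- by apply: continuous_subspaceT; exact: continuous_enorm_dist.
have : boundary Om z.
  split; last by move=> /interior_subset.
  move=> B /= /nbhs_ballP[e /= e0 Be].
  have zx0 : z != x by apply: contra_notN Omz => /eqP ->.
  (* Moving from [z] towards [x] by the fraction [t] stays in the given neighbourhood of [z] and
     strictly decreases the distance to [x]. By minimality of [z] the moved point is in [Om], so [z]
     is in the closure. *)
  pose t := Num.min (e / (2 * (`|z - x| + 1))) 1.
  have N0 : 0 < 2 * (`|z - x| + 1) by rewrite mulr_gt0// ltr_wpDl.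
  have t0 : 0 < t by rewrite lt_min ltr01 andbT divr_gt0.
  have t1 : t <= 1 by rewrite ge_min lexx orbT.
  exists (z - t *: (z - x)); split; last first.
    apply: Be; rewrite -ball_normE /ball_/= opprB addrC subrK normrZ gtr0_norm//.
    rewrite (@le_lt_trans _ _ (e / (2 * (`|z - x| + 1)) * `|z - x|))//.
      by rewrite ler_wpM2r// ge_min lexx.
    rewrite -mulrA gtr_pMr// mulrC ltr_pdivrMr// mul1r.
    by have := normr_ge0 (z - x); lra.
  apply: contrapT => Omt.
  have tE : z - t *: (z - x) - x = (1 - t) *: (z - x).
    by rewrite scalerBl scale1r addrAC.
  have zx : 0 < enorm (z - x).
    rewrite lt_def enorm_ge0 andbT; apply: contraNneq zx0 => /enorm_eq0/eqP.
    by rewrite subr_eq0.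
  have tz : enorm (z - t *: (z - x) - x) < enorm (z - x).
    rewrite tE enormZ ger0_norm ?subr_ge0// gtr_pMl//; lra.
  have := zmin (z - t *: (z - x)); rewrite leNgt tz => /(_ _)/negP; apply => //.
  by split => //; rewrite /ceball/= (le_trans (ltW tz)).
move=> /bOm; rewrite enorm_distC leNgt => /negP; apply.
exact: le_lt_trans zr xyr.
Qed.

End EuclideanNorm.

(** * Radial polynomials as test functions *)

Section RadialPolynomials.
Context {R : realType} {n : nat}.
Implicit Types (x y a v : 'rV[R]_n) (p : {poly R}).

Lemma is_derive_coord x v (i : 'I_n) :
  is_derive x v (fun y : 'rV[R]_n => y ord0 i) (v ord0 i).
Proof.
have E h : h != 0 -> h^-1 *: ((h *: v + x) ord0 i - x ord0 i) = v ord0 i.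
  by move=> h0; rewrite !mxE addrK scalerA mulVf// scale1r.
have lim : h^-1 *: ((h *: v + x) ord0 i - x ord0 i) @[h --> 0^'] --> v ord0 i.
  apply: cvg_near_cst; near=> h; apply: E; near: h.
  exact: nbhs_dnbhs_neq.
apply: DeriveDef; first by apply/cvg_ex; exists (v ord0 i).
exact: cvg_lim lim.
Unshelve. all: by end_near. Qed.

Lemma is_derive_comp_horner (s : 'rV[R]_n -> R) (ds : R) x v p :
  is_derive x v s ds ->
  is_derive x v (fun y => p.[s y]) (p^`().[s x] * ds).
Proof.
move=> sds; elim/poly_ind : p => [|p c ih].
  under eq_fun do rewrite horner0.
  by rewrite deriv0 horner0 mul0r; exact: is_derive_cst.
under eq_fun do rewrite hornerMXaddC.
apply: is_derive_eq.
rewrite derivD derivC addr0 derivM derivX mulr1 !hornerE /GRing.scale/=; ring.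
Qed.

Definition sqdist a y : R := \sum_(i < n) (y ord0 i - a ord0 i) ^+ 2.

Lemma sqdistE a y : sqdist a y = enorm (y - a) ^+ 2.
Proof. by rewrite enorm_sqr; apply: eq_bigr => i _; rewrite !mxE. Qed.

Lemma is_derive_sqdist a x v :
  is_derive x v (sqdist a) (\sum_(i < n) 2 * (x ord0 i - a ord0 i) * v ord0 i).
Proof.
rewrite /sqdist.
have -> : (fun y => \sum_(i < n) (y ord0 i - a ord0 i) ^+ 2) =
    \sum_(i < n) (fun y : 'rV[R]_n => (y ord0 i - a ord0 i) ^+ 2).
  by apply/funext => y; rewrite fct_sumE.
apply: is_derive_sum => i.
have := is_derive_coord x v i => h.
apply: is_derive_eq.
by rewrite /GRing.scale/= subr0; ring.
Qed.

Definition radial p a y : R := p.[sqdist a y].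

Lemma delta_row (i j : 'I_n) : (delta_mx ord0 i : 'rV[R]_n) ord0 j = (i == j)%:R.
Proof. by rewrite mxE eqxx eq_sym. Qed.

Lemma is_derive_radial p a x (i : 'I_n) :
  is_derive x 'e_i (radial p a) (p^`().[sqdist a x] * (2 * (x ord0 i - a ord0 i))).
Proof.
have h := is_derive_sqdist a x 'e_i.
apply: is_derive_eq (is_derive_comp_horner p h) _; congr (_ * _).
rewrite (bigD1 i)//= delta_row eqxx mulr1 big1 ?addr0// => j ji.
by rewrite delta_row eq_sym (negbTE ji) mulr0.
Qed.

Lemma partial1_radial p a (i : 'I_n) : partial [:: i] (radial p a) =
  fun x => p^`().[sqdist a x] * (2 * (x ord0 i - a ord0 i)).
Proof. by apply/funext => x /=; have h := is_derive_radial p a x i; exact: derive_val. Qed.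

Lemma is_derive_partial1_radial p a x (i j : 'I_n) :
  is_derive x 'e_i (partial [:: j] (radial p a))
   (p^`()^`().[sqdist a x] * (2 * (x ord0 i - a ord0 i)) * (2 * (x ord0 j - a ord0 j))
    + 2 * p^`().[sqdist a x] * (i == j)%:R).
Proof.
rewrite partial1_radial.
have h1 := is_derive_radial p^`() a x i.
have h2 := is_derive_coord x 'e_i j.
rewrite /radial in h1.
apply: is_derive_eq.
by rewrite -delta_row /GRing.scale/=; ring.
Qed.

Lemma partial2_radial p a (i j : 'I_n) : partial [:: i; j] (radial p a) =
  fun x => p^`()^`().[sqdist a x] * (2 * (x ord0 i - a ord0 i)) * (2 * (x ord0 j - a ord0 j))
    + 2 * p^`().[sqdist a x] * (i == j)%:R.
Proof.
apply/funext => x; have h := is_derive_partial1_radial p a x i j.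
exact: derive_val.
Qed.

Lemma continuous_radial p a : continuous (radial p a).
Proof.
move=> x; apply: (@continuous_comp _ _ _ (sqdist a) (horner p)).
  exact: continuous_sqdist.
exact: continuous_horner.
Qed.

Lemma Ck2_radial p a (Om : set 'rV[R]_n) : Ck 2 Om (radial p a).
Proof.
have cM (f g : 'rV[R]_n -> R) : continuous f -> continuous g ->
    continuous (fun x => f x * g x).
  by move=> cf cg x; apply: continuousM; [exact: cf|exact: cg].
have cD (f g : 'rV[R]_n -> R) : continuous f -> continuous g ->
    continuous (fun x => f x + g x).
  by move=> cf cg x; apply: continuousD; [exact: cf|exact: cg].
have cc k : continuous (fun x : 'rV[R]_n => 2 * (x ord0 k - a ord0 k)).
  apply: (cM (cst 2)); first exact: cst_continuous.
  by move=> x; apply: continuousB; [exact: (@coord_continuous R 1 n ord0 k)|exact: cst_continuous].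
move=> [|i [|j [|k s]]] x Omx //= _; split.
- exact: continuous_radial.
- by move=> _ i; have h := is_derive_radial p a x i; exact: ex_derive.
- have -> : 'D_('e_i) (radial p a) = partial [:: i] (radial p a) by [].
  by rewrite partial1_radial; apply: (cM _ _); [exact: (@continuous_radial p^`() a)|exact: cc].
- by move=> _ j; have h := is_derive_partial1_radial p a x j i; exact: ex_derive.
- have -> : 'D_('e_i) ('D_('e_j) (radial p a)) = partial [:: i; j] (radial p a) by [].
  rewrite partial2_radial; apply: cD.
    by apply: (cM _ _ _ (cc j)); apply: (cM _ _ _ (cc i)); exact: (@continuous_radial p^`()^`() a).
  apply: (cM _ _); last exact: cst_continuous.
  by apply: (cM _ _); [exact: cst_continuous|exact: (@continuous_radial p^`() a)].
- by [].
Qed.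

(** With d = x - a, the gradient is 2 p' d and the Hessian is 4 p'' d d^T + 2 p' I; the Hessian is
    evaluated on the gradient, and |d|^2 = s. *)
Lemma infty_laplacian_radial p a x :
  let s := sqdist a x in
  infty_laplacian (radial p a) x =
  8 * p^`().[s] ^+ 2 * s * (2 * s * p^`()^`().[s] + p^`().[s]).
Proof.
move=> s; rewrite /infty_laplacian.
pose d (i : 'I_n) := x ord0 i - a ord0 i.
transitivity (\sum_(i < n) (16 * p^`().[s] ^+ 2 * p^`()^`().[s] * s * d i ^+ 2
   + 8 * p^`().[s] ^+ 3 * d i ^+ 2)); last first.
  by rewrite big_split/= -!mulr_sumr -/(sqdist a x) -/s; ring.
apply: eq_bigr => i _.
under eq_bigr do rewrite partial2_radial !partial1_radial.
transitivity (\sum_(j < n) (16 * p^`().[s] ^+ 2 * p^`()^`().[s] * d i ^+ 2 * d j ^+ 2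
   + 8 * p^`().[s] ^+ 3 * d i * d j * (i == j)%:R)).
  by apply: eq_bigr => j _; rewrite -/s /d; ring.
rewrite big_split/= -mulr_sumr -/(sqdist a x) -/s; congr (_ + _); first by ring.
rewrite (bigD1 i)//= eqxx mulr1 big1 => [|j ji]; first by ring.
by rewrite eq_sym (negbTE ji) mulr0.
Qed.

End RadialPolynomials.

(** * Second order comparison at a maximum *)

Section SecondOrderTest.
Context {R : realType} {n : nat}.
Implicit Types (f : 'rV[R]_n -> R) (x y z v p : 'rV[R]_n).

Lemma is_derive_line f z v (t : R) : derivable f (z + t *: v) v ->
  is_derive t 1 (fun t => f (z + t *: v)) ('D_v f (z + t *: v)).
Proof.
have E : (fun h => h^-1 *: (f (z + (h *: 1 + t) *: v) - f (z + t *: v))) =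
    (fun h => h^-1 *: (f (h *: v + (z + t *: v)) - f (z + t *: v))).
  apply/funext => h; congr (_ *: (f _ - _)).
  by rewrite [h *: 1]mulr1 scalerDl addrCA.
move=> df; apply: DeriveDef.
  by move: df; rewrite /derivable/= -E.
by rewrite /derive/= -E.
Qed.

Lemma MVT_sym (g dg : R -> R) (T : R) :
  (forall t : R, `|t| <= `|T| -> is_derive t 1 g (dg t)) ->
  exists2 c, `|c| <= `|T| & g T - g 0 = dg c * T.
Proof.
move=> gdg.
have cg (a b : R) : (forall t, t \in `[a, b] -> `|t| <= `|T|) -> {within `[a, b], continuous g}.
  move=> abT; apply: derivable_within_continuous => t /abT tT.
  by have h := gdg _ tT; exact: ex_derive.
have [T0|T0] := leP 0 T.
  have sub t : t \in `[0, T] -> `|t| <= `|T|.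
    by rewrite in_itv/= => /andP[t0 tT]; rewrite !ger0_norm.
  have [||c c0T E] := @MVT_segment R g dg 0 T T0.
  - by move=> t t0T; apply/gdg/sub/subset_itv_oo_cc.
  - exact: cg.
  by exists c; [exact: sub|rewrite E subr0].
have sub t : t \in `[T, 0] -> `|t| <= `|T|.
  rewrite in_itv/= => /andP[tT t0]; rewrite !ler0_norm//; [lra|exact: ltW].
have [||c c0T E] := @MVT_segment R g dg T 0 (ltW T0).
- by move=> t t0T; apply/gdg/sub/subset_itv_oo_cc.
- exact: cg.
by exists c; [exact: sub|rewrite -opprB E sub0r mulrN opprK].
Qed.

(** [Ck] speaks only of partial derivatives. An arbitrary direction is reached by changing one
    coordinate at a time, with the mean value theorem on each leg and continuity of the partial
    derivatives to compare with [x]. *)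
Lemma C1_is_derive f x p :
  (forall i, \forall y \near x, derivable f y 'e_i) ->
  (forall i, {for x, continuous ('D_('e_i) f)}) ->
  is_derive x p f (\sum_(i < n) p ord0 i * 'D_('e_i) f x).
Proof.
move=> df cf.
suff lim : h^-1 *: (f (h *: p + x) - f x) @[h --> 0^'] -->
    \sum_(i < n) p ord0 i * 'D_('e_i) f x.
  apply: DeriveDef; first by apply/cvg_ex; eexists; exact: lim.
  exact: cvg_lim lim.
apply/cvgrPdist_le => e e0.
pose S := \sum_(i < n) `|p ord0 i| + 1.
have S0 : 0 < S by rewrite ltr_wpDl// sumr_ge0.
have : \forall y \near x, forall i, derivable f y 'e_i /\
    `|'D_('e_i) f x - 'D_('e_i) f y| <= e / S.
  apply: (@filter_forall _ _ _ (nbhs x)) => i.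
  near=> y; split; near: y; first exact: df.
  by have /cvgrPdist_le := cf i; apply; rewrite divr_gt0.
move=> /nbhs_ballP[d /= d0 Hd].
have {}Hd y : `|x - y| < d -> forall i, derivable f y 'e_i /\
    `|'D_('e_i) f x - 'D_('e_i) f y| <= e / S.
  by move=> xy; apply: Hd; rewrite -ball_normE.
near=> h.
have h0 : h != 0 by near: h; exact: nbhs_dnbhs_neq.
have hp : `|h| * `|p| < d.
  rewrite (@le_lt_trans _ _ (`|h| * (`|p| + 1)))//; first by rewrite ler_wpM2l// lerDl.
  rewrite -ltr_pdivlMr ?ltr_wpDl//.
  by near: h; apply: dnbhs0_lt; rewrite divr_gt0// ltr_wpDl.
(* [q k] has its first [k] coordinates already moved, so [q 0] is [x] and [q n] is x + h p. *)
pose q (k : nat) : 'rV[R]_n := \row_i (x ord0 i + h * p ord0 i * (i < k)%:R).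
have q0 : q 0%N = x by apply/rowP => i; rewrite mxE ltn0 mulr0 addr0.
have qn : q n = h *: p + x.
  by apply/rowP => i; rewrite !mxE ltn_ord mulr1 addrC.
have qS (i : 'I_n) : q i.+1 = q i + (h * p ord0 i) *: 'e_i.
  apply/rowP => j; rewrite !mxE eqxx /= ltnS leq_eqVlt.
  have [->|ji] := eqVneq j i; first by rewrite eqxx ltnn /= mulr0 addr0.
  by rewrite (negbTE (_ : (j : nat) != i)) ?mulr0 ?addr0.
have step (i : 'I_n) : `|f (q i.+1) - f (q i) - h * (p ord0 i * 'D_('e_i) f x)|
    <= `|h| * (`|p ord0 i| * (e / S)).
  have inb (t : R) : `|t| <= `|h * p ord0 i| -> `|x - (q i + t *: 'e_i)| < d.
    move=> tT; apply: le_lt_trans hp; apply: norm_le_coord; first by rewrite mulr_ge0.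
    move=> j; rewrite !mxE eqxx/= !opprD !addrA subrr add0r.
    case: (eqVneq j i) => [->|ji].
      rewrite ltnn mulr0 mulr1 oppr0 add0r normrN (le_trans tT)// normrM.
      by rewrite ler_wpM2l// ler_coord_norm.
    rewrite mulr0 subr0 normrN !normrM -mulrA ler_wpM2l//.
    by case: (_ < _)%N; rewrite ?normr1 ?normr0 ?mulr1 ?mulr0// ler_coord_norm.
  have [t tT|c cT E] := @MVT_sym (fun t => f (q i + t *: 'e_i))
      (fun t => 'D_('e_i) f (q i + t *: 'e_i)) (h * p ord0 i).
    by apply: is_derive_line; apply (Hd _ (inb _ tT) i).
  rewrite qS; move: E; rewrite scale0r addr0 => ->.
  have [_] := Hd _ (inb _ cT) i; set D1 := 'D__ f x; set D2 := 'D__ f _ => D12.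
  rewrite (_ : _ - _ = - (h * (p ord0 i * (D1 - D2)))); last by ring.
  by rewrite normrN !normrM !ler_wpM2l.
rewrite distrC -[f (_ + _)]/(f (h *: p + x)) -qn -{1}q0.
have -> : f (q n) - f (q 0%N) = \sum_(i < n) (f (q i.+1) - f (q i)).
  by rewrite -(big_mkord xpredT (fun i => f (q i.+1) - f (q i))) telescope_sumr.
rewrite /GRing.scale/= -[X in _ - X](mulKf h0) -mulrBr normrM normfV.
rewrite mulrC ler_pdivrMr ?normr_gt0//.
rewrite mulr_sumr -sumrB (le_trans (ler_norm_sum _ _ _))//.
rewrite (@le_trans _ _ (\sum_(i < n) `|h| * (`|p ord0 i| * (e / S))))//.
  by apply: ler_sum => i _; exact: step.
rewrite -mulr_sumr -mulr_suml mulrC ler_wpM2r// mulrCA ger_pMr//.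
by rewrite ler_pdivrMr// mul1r lerDl.
Unshelve. all: by end_near. Qed.

Lemma Ck2_is_derive (A : set 'rV[R]_n) f x p : open A -> Ck 2 A f -> A x ->
  is_derive x p f (\sum_(i < n) p ord0 i * partial [:: i] f x).
Proof.
move=> oA fC Ax; apply: C1_is_derive => i.
  have : \forall y \near x, A y by exact: open_nbhs_nbhs.
  apply: filterS => y Ay; have [_] := fC [::] y Ay isT; exact.
by have [] := fC [:: i] x Ax isT.
Qed.

Lemma Ck2_is_derive2 (A : set 'rV[R]_n) f x p (j : 'I_n) : open A -> Ck 2 A f -> A x ->
  is_derive x p (partial [:: j] f) (\sum_(i < n) p ord0 i * partial [:: i; j] f x).
Proof.
move=> oA fC Ax; apply: C1_is_derive => i.
  have : \forall y \near x, A y by exact: open_nbhs_nbhs.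
  apply: filterS => y Ay; have [_] := fC [:: j] y Ay isT; exact.
by have [] := fC [:: i; j] x Ax isT.
Qed.

End SecondOrderTest.
Section SecondOrderComparison.
Context {R : realType} {n : nat}.
Variables (A : set 'rV[R]_n) (psi th : 'rV[R]_n -> R) (x : 'rV[R]_n).
Hypotheses (oA : open A) (Ax : A x) (Cpsi : Ck 2 A psi) (Cth : Ck 2 A th).
Hypothesis maxx : \forall y \near x, psi y - th y <= psi x - th x.

Let gap (p y : 'rV[R]_n) : R :=
  \sum_(i < n) p ord0 i * (partial [:: i] psi y - partial [:: i] th y).

Let is_derive_gap (p y : 'rV[R]_n) : A y -> is_derive y p (fun y => psi y - th y) (gap p y).
Proof.
move=> Ay; have h1 := Ck2_is_derive p oA Cpsi Ay.
have h2 := Ck2_is_derive p oA Cth Ay.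
apply: is_derive_eq.
by rewrite -sumrB; apply: eq_bigr => i _; rewrite mulrBr.
Qed.

Let line_near (p : 'rV[R]_n) : \forall t \near (0 : R), A (x + t *: p) /\
  psi (x + t *: p) - th (x + t *: p) <= psi x - th x.
Proof.
have : \forall y \near x, A y /\ psi y - th y <= psi x - th x.
  by apply: filterI => //; exact: open_nbhs_nbhs.
suff : (x + t *: p) @[t --> (0 : R)] --> x by apply.
rewrite -[X in _ --> X]addr0 -[X in _ + X](scale0r p).
by apply: cvgD; [exact: cvg_cst|apply: cvgZ; [exact: cvg_id|exact: cvg_cst]].
Qed.

Let line_ball (p : 'rV[R]_n) : exists2 d : R, 0 < d & forall t, `|t| < d -> A (x + t *: p) /\
  psi (x + t *: p) - th (x + t *: p) <= psi x - th x.
Proof.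
have /nbhs_ballP[d /= d0 Hd] := line_near p.
by exists d => // t td; apply: Hd; rewrite -ball_normE /ball_/= sub0r normrN.
Qed.

Let is_derive_gline (p : 'rV[R]_n) (t : R) : A (x + t *: p) ->
  is_derive t 1 (fun t => psi (x + t *: p) - th (x + t *: p)) (gap p (x + t *: p)).
Proof.
move=> At; have h := is_derive_gap p At.
have hd : derivable (fun y => psi y - th y) (x + t *: p) p by exact: ex_derive.
by have := is_derive_line hd; rewrite derive_val.
Qed.

Let gap0 (p : 'rV[R]_n) : gap p x = 0.
Proof.
have [d d0 Hd] := line_ball p.
have d20 : - (d / 2) < d / 2 by lra.
have inb t : t \in `](- (d / 2)), (d / 2)[ -> `|t| < d.
  by rewrite in_itv/= ltr_norml => /andP[? ?]; apply/andP; split; lra.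
have := @derive1_at_max R (fun t => psi (x + t *: p) - th (x + t *: p))
  (- (d / 2)) (d / 2) 0 (ltW d20).
have in0 : 0 \in `](- (d / 2)), (d / 2)[ by rewrite in_itv/=; apply/andP; split; lra.
move=> /(_ _ in0 _).
have h : is_derive (0 : R) 1 (fun t => psi (x + t *: p) - th (x + t *: p)) (gap p x).
  by have := @is_derive_gline p 0; rewrite scale0r addr0; apply.
case=> [t /inb /Hd [At _]|t /inb /Hd [_ Ht]|_ <-].
- by have ht := is_derive_gline At; exact: ex_derive.
- by rewrite scale0r addr0.
- by rewrite derive_val.
Qed.

Lemma partial1_eq_at_max i : partial [:: i] psi x = partial [:: i] th x.
Proof.
have := gap0 'e_i; rewrite /gap (bigD1 i)//= big1 ?addr0.
  by rewrite !mxE !eqxx mul1r => /eqP; rewrite subr_eq0 => /eqP.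
by move=> j ji; rewrite !mxE (negbTE ji) andbF mul0r.
Qed.

(** On the line x + t p the derivative of psi - th vanishes at t = 0. Were its second derivative [Q]
    positive, the first would be positive just after 0, and the mean value theorem would push psi -
    th above its maximum. *)
Lemma hessian_le_at_max (p : 'rV[R]_n) :
  \sum_(i < n) \sum_(j < n) p ord0 i * p ord0 j * partial [:: i; j] psi x <=
  \sum_(i < n) \sum_(j < n) p ord0 i * p ord0 j * partial [:: i; j] th x.
Proof.
rewrite leNgt; apply/negP => lt_hess.
pose Q := \sum_(j < n) p ord0 j *
  (\sum_(i < n) p ord0 i * partial [:: i; j] psi x -
   \sum_(i < n) p ord0 i * partial [:: i; j] th x).
have Q0 : 0 < Q.
  move: lt_hess; rewrite -subr_gt0 -sumrB; congr (0 < _).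
  transitivity (\sum_(i < n) \sum_(j < n)
     (p ord0 i * p ord0 j * partial [:: i; j] psi x -
      p ord0 i * p ord0 j * partial [:: i; j] th x)).
    by apply: eq_bigr => i _; rewrite sumrB.
  rewrite exchange_big; apply: eq_bigr => j _.
  rewrite -sumrB mulr_sumr; apply: eq_bigr => i _ /=; ring.
have hG : is_derive x p (gap p) Q.
  rewrite /gap (_ : (fun y => _) = \sum_(i < n) (fun y =>
     p ord0 i * (partial [:: i] psi y - partial [:: i] th y))); last first.
    by apply/funext => y; rewrite fct_sumE.
  apply: is_derive_sum => j.
  have h1 := Ck2_is_derive2 p j oA Cpsi Ax.
  have h2 := Ck2_is_derive2 p j oA Cth Ax.
  by apply: is_derive_eq; rewrite /GRing.scale/= ?mulr0 ?mul0r ?addr0 ?add0r.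
have lim : h^-1 * gap p (x + h *: p) @[h --> 0^'] --> Q.
  have [/cvg_ex[l hl] hQ] := hG.
  have hl' := cvg_lim (@norm_hausdorff _ _) hl.
  rewrite -hQ /derive hl'.
  apply: cvg_trans hl; apply: near_eq_cvg; near=> h.
  by rewrite /= gap0 subr0 addrC.
have [d d0 Hd] := line_ball p.
have : \forall h \near 0^', 0 < h^-1 * gap p (x + h *: p).
  by move/cvgr_gt : lim; apply.
rewrite near_withinE => /nbhs_ballP[e /= e0 He].
pose T := Num.min d e / 2.
have de : 0 < Num.min d e by rewrite lt_min d0.
have T0 : 0 < T by rewrite divr_gt0.
have Td : T < d by rewrite (@lt_le_trans _ _ (Num.min d e)) ?ge_min ?lexx// /T; lra.
have Te : T < e by rewrite (@lt_le_trans _ _ (Num.min d e)) ?ge_min ?lexx ?orbT// /T; lra.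
have [||c] := @MVT R (fun t => psi (x + t *: p) - th (x + t *: p))
    (fun t => gap p (x + t *: p)) 0 T T0.
- move=> t /[!in_itv]/= /andP[t0 tT]; apply: is_derive_gline.
  by apply: (proj1 (Hd _ _)); rewrite gtr0_norm// (lt_trans tT).
- apply: derivable_within_continuous => t /[!in_itv]/= /andP[t0 tT].
  have /is_derive_gline h : A (x + t *: p).
    by apply: (proj1 (Hd _ _)); rewrite ger0_norm// (le_lt_trans tT).
  exact: ex_derive.
rewrite in_itv/= => /andP[c0 cT] E.
have : 0 < gap p (x + c *: p).
  have := He c; rewrite -ball_normE/= sub0r normrN gtr0_norm// (lt_trans cT)//.
  move=> /(_ isT); rewrite gt_eqF// => /(_ isT).
  by rewrite pmulr_rgt0// invr_gt0.
have := proj2 (Hd T _); rewrite gtr0_norm// => /(_ Td).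
rewrite -subr_le0; move: E; rewrite scale0r addr0 subr0 => ->.
by rewrite leNgt => /negP h1 h2; apply: h1; rewrite mulr_gt0.
Unshelve. all: by end_near. Qed.

(** The two gradients agree at [x], so this is the Hessian comparison in that common direction. It
    turns the bowl, a classical supersolution, into a viscosity one. *)
Lemma infty_laplacian_le_at_max : infty_laplacian psi x <= infty_laplacian th x.
Proof.
have := hessian_le_at_max (\row_i partial [:: i] psi x).
congr (_ <= _); apply: eq_bigr => i _; apply: eq_bigr => j _.
  by rewrite !mxE; ring.
by rewrite !mxE !partial1_eq_at_max; ring.
Qed.

End SecondOrderComparison.

(** * Volume of balls *)

Section OuterMeasure.
Context {R : realType}.

Lemma card_lattice_interval (N : nat) (a b c h : R) : 0 < h -> a <= b ->
  (#|[pred j : 'I_N | a <= c + h * j%:R <= b]|)%:R <= (b - a) / h + 1.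
Proof.
move=> h0 ab; set P := [pred j : 'I_N | _].
have [j0 Pj0|nP] := pickP P; last first.
  by rewrite (eq_card0 nP) ler_wpDl// divr_ge0 ?subr_ge0// ltW.
have [m Pm minm] := @arg_minnP _ j0 P (fun j : 'I_N => j : nat) Pj0.
have [M PM maxM] := @arg_maxnP _ j0 P (fun j : 'I_N => j : nat) Pj0.
have mM : (m <= M)%N by exact: minm.
have cP : (#|P| <= M - m + 1)%N.
  rewrite cardE -(size_map (fun j : 'I_N => j : nat)) -[leqRHS](size_iota m).
  apply: uniq_leq_size; first by rewrite map_inj_uniq ?enum_uniq//; exact: val_inj.
  move=> k /mapP[j]; rewrite mem_enum => Pj ->.
  by rewrite mem_iota minm//= addnA subnKC// addn1 ltnS; exact: maxM.
rewrite (@le_trans _ _ (M - m + 1)%:R)//; first by rewrite ler_nat.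
rewrite natrD lerD2r natrB// ler_pdivlMr//.
move: Pm PM => /=/andP[am _] /andP[_ Mb]; rewrite mulrC mulrBr; lra.
Qed.

Context {n : nat}.
Implicit Types (a b c : 'rV[R]_n) (A B : set 'rV[R]_n).

Definition cube c (l : R) : set 'rV[R]_n :=
  [set x | forall i, c ord0 i <= x ord0 i <= c ord0 i + l].

(* Counting the points of a lattice of step [l / N] in each of the boxes. *)
Lemma cube_cover_lattice (K N : nat) (a b : nat -> 'rV[R]_n) c (l : R) :
  0 < l -> (0 < N)%N -> (forall k i, a k ord0 i <= b k ord0 i) ->
  cube c l `<=` [set x | exists2 k, (k < K)%N & box (a k) (b k) x] ->
  l ^+ n <= \sum_(k < K) \prod_(i < n) (b k ord0 i - a k ord0 i + l / N%:R).
Proof.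
move=> l0 N0 ab cov.
have NR0 : 0 < N%:R :> R by rewrite ltr0n.
pose h := l / N%:R; have h0 : 0 < h by rewrite divr_gt0.
pose F (k : nat) (i : 'I_n) : pred 'I_N :=
  [pred j : 'I_N | a k ord0 i <= c ord0 i + h * j%:R <= b k ord0 i].
have H1 : (#|{ffun 'I_n -> 'I_N}| <= \sum_(k < K) #|(family (F k) : simpl_pred {ffun 'I_n -> 'I_N})|)%N.
  rewrite -sum1_card.
  under [leqRHS]eq_bigr do rewrite -sum1_card big_mkcond/=.
  rewrite exchange_big/=; apply: leq_sum => f _.
  have [|k kK bk] := cov (\row_i (c ord0 i + h * (f i)%:R)).
    move=> i; rewrite mxE lerDl mulr_ge0 ?(ltW h0)//= lerD2l.
    by rewrite /h mulrAC ler_pdivrMr// ler_pM2l// ler_nat ltnW.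
  rewrite (bigD1 (Ordinal kK))//= (_ : f \in family (F k)) ?leq_addr//.
  by apply/familyP => i; have := bk i; rewrite mxE.
have H2 (k : 'I_K) : (#|(family (F k) : simpl_pred {ffun 'I_n -> 'I_N})|)%:R <=
    \prod_(i < n) ((b k ord0 i - a k ord0 i) / h + 1).
  rewrite card_family foldrE big_image/= natr_prod.
  by apply: ler_prod => i _; rewrite ler0n card_lattice_interval.
have H3 : N%:R ^+ n <= \sum_(k < K) \prod_(i < n) ((b k ord0 i - a k ord0 i) / h + 1).
  move: H1; rewrite card_ffun !card_ord -(ler_nat R) natrX => /le_trans; apply.
  by rewrite natr_sum; apply: ler_sum => k _; exact: H2.
have -> : l ^+ n = h ^+ n * N%:R ^+ n by rewrite -exprMn divfK// gt_eqF.
rewrite (le_trans (ler_wpM2l _ H3)) ?exprn_ge0 ?(ltW h0)//.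
rewrite mulr_sumr; apply: ler_sum => k _.
rewrite -[X in _ ^+ X]card_ord -prodr_const -big_split/=.
apply: ler_prod => i _; apply/andP; split.
  by rewrite mulr_ge0 ?(ltW h0)// addr_ge0// mulr_ge0 ?subr_ge0 ?ab// invr_ge0 ltW.
by rewrite mulrDr mulr1 mulrC divfK// gt_eqF.
Qed.

(** The 3 counts the growth of a side: [t] at each end when the closed box is enlarged to an open
    one, and one lattice step, at most [t], in the counting estimate. *)
Lemma box_volume_near a b (e : R) : 0 < e ->
  exists2 t : R, 0 < t &
    \prod_(i < n) (b ord0 i - a ord0 i + 3 * t) <= box_volume a b + e.
Proof.
move=> e0.
pose p : {poly R} := \prod_(i < n) ((b ord0 i - a ord0 i)%:P + 3%:P * 'X).
have pE t : p.[t] = \prod_(i < n) (b ord0 i - a ord0 i + 3 * t).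
  by rewrite horner_prod; apply: eq_bigr => i _; rewrite !hornerE.
have p0 : p.[0] = box_volume a b.
  by rewrite pE; apply: eq_bigr => i _; rewrite mulr0 addr0.
have /cvgrPdist_le /(_ e e0) /nbhs_ballP[d /= d0 Hd] := @continuous_horner R p 0.
exists (d / 2); first by rewrite divr_gt0.
rewrite -pE -p0 -lerBlDl; have := Hd (d / 2).
rewrite -ball_normE/= sub0r normrN gtr0_norm ?divr_gt0// => /(_ _).
rewrite distrC => h; rewrite (le_trans (ler_norm _))// h// ltr_pdivrMr//; lra.
Qed.

(** The boxes of a countable cover are enlarged to open ones at total cost [e]; compactness leaves
    finitely many, to which the lattice count applies. *)
Lemma lebesgue_n_cube_ge c (l : R) : 0 < l -> ((l ^+ n)%:E <= lebesgue_n (cube c l))%E.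
Proof.
move=> l0; apply: le_ereal_inf_tmp => _ [a [b [ab cov ->]]].
apply/lee_addgt0Pr => e e0.
have V0 k : 0 <= box_volume (a k) (b k).
  by apply: prodr_ge0 => i _; rewrite subr_ge0.
(* The error [e] is shared out as e / 2 ^ (k + 1) among the boxes. *)
apply: le_trans (@epsilon_trick R (fun k => (box_volume (a k) (b k))%:E) e xpredT _ (ltW e0)); last first.
  by move=> k; rewrite lee_fin.
have e2 k : 0 < e / (2 ^ k.+1)%:R by rewrite divr_gt0// ltr0n expn_gt0.
have /choice[t Ht] (k : nat) : exists t : R, 0 < t /\
    \prod_(i < n) (b k ord0 i - a k ord0 i + 3 * t) <=
      box_volume (a k) (b k) + e / (2 ^ k.+1)%:R.
  by have [t t0 Ht] := box_volume_near (a k) (b k) (e2 k); exists t.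
pose U k : set 'rV[R]_n := [set x | forall i, a k ord0 i - t k < x ord0 i < b k ord0 i + t k].
have oU k : open (U k).
  rewrite openE => x Ux.
  apply: (@filter_forall _ _ (fun i => [set y : 'rV[R]_n |
    a k ord0 i - t k < y ord0 i < b k ord0 i + t k]) (nbhs x)) => i.
  have /andP[lo hi] := Ux i.
  have ci := @coord_continuous R 1 n ord0 i x.
  near=> y => /=; apply/andP; split; near: y.
    by move/cvgr_gt : ci; apply.
  by move/cvgr_lt : ci; apply.
have cQ : compact (cube c l).
  have -> : cube c l = [set x | forall i, `[c ord0 i, c ord0 i + l]%classic (x ord0 i)].
    by apply/seteqP; split=> x xc i; have := xc i; rewrite /= in_itv/=.
  by apply: (@rV_compact _ n (fun i => `[c ord0 i, c ord0 i + l]%classic)) => i; exact: segment_compact.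
move: cQ; rewrite compact_cover => /(_ nat setT U (fun k _ => oU k)).
case=> [x cx|D _ HD].
  have [k _ bk] := cov _ cx; exists k => // i; have /andP[lo hi] := bk i.
  by have [tk _] := Ht k; apply/andP; split; lra.
pose K := (\max_(k <- D) k).+1.
have DK k : k \in D -> (k < K)%N.
  by move=> kD; rewrite ltnS; apply: (@leq_bigmax_seq _ _ xpredT id).
(* A sum dominates each of its terms, so this [N] makes the step l / N at most [t k] for all k < K
   at once. *)
pose N := (\sum_(k < K) (Num.trunc (l / t k)).+1).+1.
have NR0 : 0 < N%:R :> R by rewrite ltr0n.
have HN (k : 'I_K) : l / N%:R <= t k.
  have [tk _] := Ht k.
  rewrite ler_pdivrMr// mulrC -ler_pdivrMr//.
  rewrite (@le_trans _ _ (Num.trunc (l / t k)).+1%:R)//.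
    by rewrite ltW// truncnS_gt.
  by rewrite ler_nat /N (bigD1 k)//= ltnW// ltnS leq_addr.
have H1 k i : (a k - const_mx (t k)) ord0 i <= (b k + const_mx (t k)) ord0 i.
  by rewrite !mxE; have := ab k i; have [tk _] := Ht k; lra.
have H2 : cube c l `<=` [set x | exists2 k, (k < K)%N &
    box (a k - const_mx (t k)) (b k + const_mx (t k)) x].
  move=> x /HD[k kD Uk]; exists k; first exact: DK.
  by move=> i; rewrite !mxE; have /andP[lo hi] := Uk i; apply/andP; split; exact: ltW.
have H := @cube_cover_lattice K N (fun k => a k - const_mx (t k))
  (fun k => b k + const_mx (t k)) c l l0 isT H1 H2.
apply: (@le_trans _ _ (\sum_(0 <= k < K) ((box_volume (a k) (b k))%:E + (e / (2 ^ k.+1)%:R)%:E)))%E; last first.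
  by apply: nneseries_lim_ge => k _ _; rewrite -EFinD lee_fin addr_ge0// ltW.
rewrite big_mkord.
under eq_bigr do rewrite -EFinD.
rewrite sumEFin lee_fin (le_trans H)//; apply: ler_sum => k _.
have [tk Hk] := Ht k; apply: le_trans Hk.
apply: ler_prod => i _; rewrite !mxE.
have := HN k; have := ab k i; have : 0 <= l / N%:R by rewrite divr_ge0 ?ltW.
by set u := l / _ => *; apply/andP; split; lra.
Unshelve. all: by end_near. Qed.

Lemma le_lebesgue_n A B : A `<=` B -> (lebesgue_n A <= lebesgue_n B)%E.
Proof.
move=> AB; apply: ereal_inf_le_tmp => _ [a [b [ab Bc ->]]].
by exists a, b; split => //; exact: subset_trans Bc.
Qed.

Lemma lebesgue_n_box_le a b : (0 < n)%N -> (forall i, a ord0 i <= b ord0 i) ->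
  (lebesgue_n (box a b) <= (box_volume a b)%:E)%E.
Proof.
move=> n0 ab; apply: ge_ereal_inf.
(* The cover must be an infinite sequence: the box is followed by copies of the point 0, whose
   volume is 0 because n > 0 (for n = 0 the empty product would be 1). *)
pose a' (k : nat) : 'rV[R]_n := if k == 0%N then a else 0.
pose b' (k : nat) : 'rV[R]_n := if k == 0%N then b else 0.
have V0 k : 0 <= box_volume (a' k) (b' k).
  by apply: prodr_ge0 => i _; rewrite subr_ge0; case: k => [|k] /=.
exists (\sum_(0 <= k <oo) (box_volume (a' k) (b' k))%:E)%E.
  exists a', b'; split => //; first by move=> [|k] i /=.
  by move=> x xab; exists 0%N.
rewrite (nneseries_split 0 1)/= => [|k _]; last by rewrite lee_fin.
rewrite big_nat1 eseries0 ?adde0// => -[|k]// _ _ /=.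
by rewrite /box_volume (bigD1 (Ordinal n0))//= subrr mul0r.
Qed.

Lemma lebesgue_n_eball_le (x : 'rV[R]_n) (r : R) : (0 < n)%N -> 0 < r ->
  (lebesgue_n (eball x r) <= ((2 * r) ^+ n)%:E)%E.
Proof.
move=> n0 r0.
apply: (@le_trans _ _ (lebesgue_n (box (x - const_mx r) (x + const_mx r)))).
  apply: le_lebesgue_n => y yr i; rewrite !mxE.
  have := le_lt_trans (ler_coord_enorm (y - x) i) yr; rewrite !mxE.
  by rewrite ltr_norml => /andP[? ?]; apply/andP; split; lra.
rewrite (le_trans (lebesgue_n_box_le n0 _))//.
  by move=> i; rewrite !mxE; lra.
rewrite lee_fin /box_volume -[X in _ ^+ X]card_ord -prodr_const.
by apply: ler_prod => i _; rewrite !mxE; apply/andP; split; lra.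
Qed.

Lemma lebesgue_n_eball_ge (x : 'rV[R]_n) (r : R) : (0 < n)%N -> 0 < r ->
  (((r / n%:R) ^+ n)%:E <= lebesgue_n (eball x r))%E.
Proof.
move=> n0 r0; have nR0 : 0 < n%:R :> R by rewrite ltr0n.
pose l := r / n%:R; have l0 : 0 < l by rewrite divr_gt0.
apply: le_trans (lebesgue_n_cube_ge (x - const_mx (l / 2)) l0) _.
apply: le_lebesgue_n => y yl.
rewrite /eball/= (@le_lt_trans _ _ (n%:R * (l / 2)))//.
  apply: enorm_le_coord => i; have := yl i; rewrite !mxE ler_norml.
  by move=> /andP[? ?]; apply/andP; split; lra.
by rewrite /l mulrA mulrCA divff ?gt_eqF// mulr1; lra.
Qed.

(** A ball of radius [r] contains a cube of side r / n, and a ball of radius [k] lies in a box of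
    side 2 k; the bound is the ratio of the two volumes. *)
Lemma lebesgue_n_density (A : set 'rV[R]_n) (x p : 'rV[R]_n) (r k : R) : (0 < n)%N ->
  0 < r -> 0 < k -> eball p r `<=` A -> A `<=` eball x k ->
  (((r / (2 * k * n%:R)) ^+ n)%:E <= lebesgue_n A / lebesgue_n (eball x k))%E.
Proof.
move=> n0 r0 k0 pA Ax.
have nR0 : 0 < n%:R :> R by rewrite ltr0n.
have loA := le_trans (lebesgue_n_eball_ge p n0 r0) (le_lebesgue_n pA).
have hiA := le_lebesgue_n Ax.
have hix := lebesgue_n_eball_le x n0 k0.
have lox := le_trans loA hiA.
move: loA hiA hix lox.
set mA := lebesgue_n A; set mx := lebesgue_n (eball x k).
have c0 : 0 < (r / n%:R) ^+ n by rewrite exprn_gt0 ?divr_gt0.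
case: mx => [mx| |]//; case: mA => [mA| |]//; rewrite !lee_fin => loA hiA hix lox.
have mx0 : 0 < mx by exact: lt_le_trans lox.
rewrite inver gt_eqF// -EFinM lee_fin ler_pdivlMr//.
apply: le_trans loA.
rewrite (@le_trans _ _ ((r / (2 * k * n%:R)) ^+ n * (2 * k) ^+ n))//.
  by rewrite ler_wpM2l// exprn_ge0// divr_ge0 ?mulr_ge0 ?ltW.
rewrite -exprMn (_ : _ * (2 * k) = r / n%:R)//.
by field; rewrite !gt_eqF.
Qed.

End OuterMeasure.

(** * A polynomial test function below the power of a cone *)

Section PowerInequalities.
Context {R : realType}.

(** This is Young's inequality for x ^ b and 1 with exponents 1 / b and 1 / (1 - b). *)
Lemma powR_bernoulli (x b : R) : 0 < x -> 0 < b < 1 -> x `^ b <= 1 + b * (x - 1).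
Proof.
move=> x0 /andP[b0 b1].
have q0 : 0 < (1 - b)^-1 by rewrite invr_gt0 subr_gt0.
have := @conjugate_powR R (x `^ b) 1 b^-1 (1 - b)^-1 (powR_ge0 _ _) ler01.
rewrite !invrK => /(_ _ q0 _); rewrite invr_gt0 b0 => /(_ isT).
rewrite (addrC b) subrK => /(_ erefl).
rewrite mulr1 -powRrM divff ?gt_eqF// powRr1 ?(ltW x0)// powR1 mul1r.
by move=> /le_trans; apply; rewrite le_eqVlt; apply/orP; left; apply/eqP; ring.
Qed.

(** Bernoulli for the inverse of 1 + h gives (1 + h) ^ b >= (1 + h) / D with D = 1 + (1 - b) h. The
    quadratic coefficient b^2 / 2, smaller than the Taylor coefficient b (1 + b) / 2, leaves the
    remainder (2 - D) b^2 h^2 / 2, nonnegative since D <= 2. *)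
Lemma powR_quadratic_lower (h b : R) : 0 < b < 1 -> -1 < h -> h <= 1 ->
  1 + (1 + b) * h + b ^+ 2 / 2 * h ^+ 2 <= (1 + h) `^ (1 + b).
Proof.
move=> b01 hl hu; have /andP[b0 b1] := b01.
have x0 : 0 < 1 + h by lra.
pose D := 1 + (1 - b) * h.
have D0 : 0 < D by rewrite /D; nra.
have D2 : D <= 2 by rewrite /D; nra.
have xb : (1 + h) / D <= (1 + h) `^ b.
  have := @powR_bernoulli (1 + h)^-1 b; rewrite invr_gt0 => /(_ x0 b01).
  have -> : (1 + h)^-1 `^ b = ((1 + h) `^ b)^-1.
    by rewrite -powR_inv1 ?ltW// -powRrM mulN1r powRN.
  have -> : 1 + b * ((1 + h)^-1 - 1) = ((1 + h) / D)^-1.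
    by rewrite invf_div /D; field; rewrite gt_eqF.
  by rewrite lef_pV2// posrE ?divr_gt0 ?powR_gt0.
rewrite powRD; last by apply/implyP => _; rewrite gt_eqF.
rewrite powRr1 ?(ltW x0)//.
apply: le_trans (ler_wpM2l (ltW x0) xb).
rewrite [leRHS]mulrA ler_pdivlMr//.
have : 0 <= (2 - D) * (b ^+ 2 * h ^+ 2) by apply: mulr_ge0; [rewrite subr_ge0|apply: mulr_ge0; exact: sqr_ge0].
move=> h1; rewrite -subr_ge0; set d := (X in 0 <= X).
have -> : d = (2 - D) * (b ^+ 2 * h ^+ 2) / 2 by rewrite /d /D; field.
by rewrite divr_ge0.
Qed.

(** The bound is the Taylor polynomial of odd order 3: it lies above the root, and its agreement to
    second order means that replacing the root by it changes neither first nor second derivatives at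
    k = 0. *)
Lemma sqrt_cubic_upper (k : R) : `|k| <= 1 / 2 ->
  Num.sqrt (1 + k) <= 1 + (k / 2 - k ^+ 2 / 8 + k ^+ 3 / 16).
Proof.
rewrite ler_norml => /andP[kl ku].
have q0 : 0 <= 1 + (k / 2 - k ^+ 2 / 8 + k ^+ 3 / 16).
  have k20 : 0 <= k ^+ 2 by exact: sqr_ge0.
  have k21 : 0 <= (1 / 2 - k) * (1 / 2 + k) by apply: mulr_ge0; lra.
  have k3 : 0 <= (1 / 2 + k) * k ^+ 2 by apply: mulr_ge0 => //; lra.
  have E3 : (1 / 2 + k) * k ^+ 2 = k ^+ 2 / 2 + k ^+ 3 by ring.
  have E2 : (1 / 2 - k) * (1 / 2 + k) = 1 / 4 - k ^+ 2 by field.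
  rewrite E3 in k3; rewrite E2 in k21; lra.
rewrite -(ler_pXn2r (n := 2))// ?nnegrE ?sqrtr_ge0// sqr_sqrtr; last lra.
rewrite -subr_ge0.
have -> : (1 + (k / 2 - k ^+ 2 / 8 + k ^+ 3 / 16)) ^+ 2 - (1 + k) =
    k ^+ 4 * ((k / 16 - 1 / 8) ^+ 2 + 1 / 16) by field.
by rewrite mulr_ge0 ?addr_ge0 ?sqr_ge0// -[4%N]/(2 * 2)%N exprM sqr_ge0.
Qed.

(* A polynomial in [s = |y - y0| ^ 2] touching from below the power of a cone of
   slope [L], and keeping a fraction of its second radial derivative. *)
Lemma cone_test_poly (t1 r1 L b : R) : 0 < t1 -> 0 < r1 -> 0 < b < 1 -> 0 <= L ->
  exists P : {poly R}, [/\ P.[r1 ^+ 2] = t1 `^ (1 + b),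
    \forall s \near r1 ^+ 2, 0 < t1 - L * (Num.sqrt s - r1) /\
       P.[s] <= (t1 - L * (Num.sqrt s - r1)) `^ (1 + b) &
    8 * P^`().[r1 ^+ 2] ^+ 2 * r1 ^+ 2 *
      (2 * r1 ^+ 2 * P^`()^`().[r1 ^+ 2] + P^`().[r1 ^+ 2]) =
    (t1 `^ (1 + b)) ^+ 3 / t1 ^+ 4 * ((1 + b) ^+ 2 * b ^+ 2 * L ^+ 4)].
Proof.
move=> t0 r0 b01 L0; have /andP[b0 b1] := b01.
pose s1 := r1 ^+ 2; have s10 : 0 < s1 by rewrite exprn_gt0.
(* [kp] is the relative change of [s], [G] stands for sqrt (1 + k) - 1, [hp] is the resulting
   relative change of the cone value [t1], and [Q] is the quadratic lower bound for its power. *)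
pose c := - (L * r1 / t1).
pose kp : {poly R} := s1^-1 *: ('X - s1%:P).
pose G : {poly R} := 2^-1 *: 'X - 8^-1 *: 'X^2 + 16^-1 *: 'X^3.
pose hp := c *: (G \Po kp).
pose Q : {poly R} := t1 `^ (1 + b) *: (1 + (1 + b) *: 'X + (b ^+ 2 / 2) *: 'X^2).
have kp1 : kp.[s1] = 0 by rewrite /kp !hornerE subrr mulr0.
have hp1 : hp.[s1] = 0 by rewrite /hp hornerZ horner_comp kp1 /G !hornerE /=; ring.
have dkp : kp^`() = (s1^-1)%:P.
  by rewrite /kp derivZ derivB derivX derivC subr0 -mul_polyC mulr1.
have dhp : hp^`() = c *: ((G^`() \Po kp) * (s1^-1)%:P).
  by rewrite /hp derivZ deriv_comp dkp.
have ddhp : hp^`()^`() = c *: ((G^`()^`() \Po kp) * (s1^-1)%:P * (s1^-1)%:P).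
  by rewrite dhp derivZ derivM derivC mulr0 addr0 deriv_comp dkp.
have dG : G^`().[0] = 2^-1 by rewrite /G !poly.derivE /= !hornerE /=; ring.
have ddG : G^`()^`().[0] = - 4^-1.
  by rewrite /G !poly.derivE /= !hornerE /=; field.
have dQ : Q^`().[0] = t1 `^ (1 + b) * (1 + b) by rewrite /Q !poly.derivE /= !hornerE /=; ring.
have ddQ : Q^`()^`().[0] = t1 `^ (1 + b) * b ^+ 2 by rewrite /Q !poly.derivE /= !hornerE /=; field.
exists (Q \Po hp); split.
- by rewrite horner_comp -/s1 hp1 /Q !hornerE /=; ring.
- have nk : \forall s \near s1, `|kp.[s]| <= 1 / 2.
    have /cvgrPdist_le /(_ (1 / 2)) := @continuous_horner R kp s1.
    rewrite kp1 divr_gt0// => /(_ isT); apply: filterS => s.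
    by rewrite sub0r normrN.
  have nh : \forall s \near s1, `|hp.[s]| <= 1 / 2.
    have /cvgrPdist_le /(_ (1 / 2)) := @continuous_horner R hp s1.
    rewrite hp1 divr_gt0// => /(_ isT); apply: filterS => s.
    by rewrite sub0r normrN.
  near=> s.
  have ks : `|kp.[s]| <= 1 / 2 by near: s.
  have : `|hp.[s]| <= 1 / 2 by near: s.
  rewrite ler_norml => /andP[hl hu].
  have kE : s = s1 * (1 + kp.[s]) by rewrite /kp !hornerE; field; rewrite gt_eqF.
  have sq : Num.sqrt s <= r1 * (1 + G.[kp.[s]]).
    rewrite [X in Num.sqrt X]kE sqrtrM ?(ltW s10)// /s1 sqrtr_sqr gtr0_norm//.
    apply: ler_wpM2l; first exact: ltW.
    apply: le_trans (sqrt_cubic_upper ks) _; rewrite le_eqVlt; apply/orP; left.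
    by apply/eqP; rewrite /G !hornerE /=; field; rewrite gt_eqF.
  have hE : hp.[s] = c * G.[kp.[s]] by rewrite /hp hornerZ horner_comp.
  (* The cone decreases in sqrt s, so an upper bound for the root gives a lower bound for the
     cone. *)
  have base : t1 * (1 + hp.[s]) <= t1 - L * (Num.sqrt s - r1).
    have -> : t1 * (1 + hp.[s]) = t1 - L * (r1 * (1 + G.[kp.[s]]) - r1).
      by rewrite hE /c; field; rewrite gt_eqF.
    by apply: lerB => //; apply: ler_wpM2l => //; apply: lerB.
  have h0 : 0 < 1 + hp.[s] by lra.
  have th0 : 0 < t1 * (1 + hp.[s]) by rewrite mulr_gt0.
  split; first exact: lt_le_trans base.
  apply: (@le_trans _ _ ((t1 * (1 + hp.[s])) `^ (1 + b))).
    rewrite powRM ?(ltW t0) ?(ltW h0)// horner_comp /Q !hornerE /=.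
    apply: ler_wpM2l; first exact: powR_ge0.
    have hm1 : -1 < hp.[s] by lra.
    have h1 : hp.[s] <= 1 by lra.
    have hE' : hp.[s] = c * (G \Po kp).[s] by rewrite /hp hornerZ.
    have := powR_quadratic_lower b01 hm1 h1; rewrite hE' => hq.
    apply: le_trans hq.
    by rewrite le_eqVlt; apply/orP; left; apply/eqP; field.
  apply: ge0_ler_powR => //; rewrite ?nnegrE; first lra.
    exact: ltW.
  exact: le_trans (ltW th0) base.
- rewrite -/s1.
  have -> : (Q \Po hp)^`().[s1] = t1 `^ (1 + b) * (1 + b) * (c / (2 * s1)).
    rewrite deriv_comp hornerM horner_comp hp1 dQ dhp hornerZ hornerM horner_comp kp1 dG hornerC.
    by field; rewrite gt_eqF.
  have -> : (Q \Po hp)^`()^`().[s1] = t1 `^ (1 + b) * b ^+ 2 * (c / (2 * s1)) ^+ 2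
      - t1 `^ (1 + b) * (1 + b) * (c / (4 * s1 ^+ 2)).
    rewrite deriv_comp derivM deriv_comp hornerD !hornerM !horner_comp hp1 dQ ddQ ddhp dhp.
    rewrite !hornerZ !hornerM !horner_comp kp1 dG ddG !hornerC.
    by field; rewrite gt_eqF.
  rewrite /c; set T := t1 `^ _; rewrite /s1.
  by field; rewrite !gt_eqF.
Unshelve. all: by end_near. Qed.

Lemma powR_continuous_gt0 (p x : R) : 0 < x -> {for x, continuous (@powR R ^~ p)}.
Proof.
move=> x0; apply: differentiable_continuous; apply/derivable1_diffP.
by apply: derivable_powR; rewrite in_itv/= x0.
Qed.

End PowerInequalities.

(** * Comparison with cones and the penalty *)

Section Continuity.
Context {R : realType} {n : nat}.
Implicit Types (Om : set 'rV[R]_n) (w : 'rV[R]_n -> R) (x : 'rV[R]_n).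

Lemma within_closure_continuous Om w x : open Om ->
  {within closure Om, continuous w} -> Om x -> {for x, continuous w}.
Proof.
move=> oOm cw Omx.
have : {within Om, continuous w} by apply: continuous_subspaceW cw; exact: subset_closure.
by rewrite continuous_open_subspace// => /(_ x); apply; exact/mem_set.
Qed.

End Continuity.

Section ConeComparison.
Context {R : realType} {n : nat}.
Implicit Types (Om : set 'rV[R]_n) (w : 'rV[R]_n -> R) (x : 'rV[R]_n).

(** The last identity is the scaling law: the infinity Laplacian of r ^ alpha is of order r ^ (3
    alpha - 4), which has to balance (r ^ alpha) ^ (- gamma). *)
Lemma alpha_exponent (gamma : R) : 0 <= gamma -> gamma < 1 ->
  [/\ 1 < alpha gamma, alpha gamma < 2 & 3 * alpha gamma - 4 = - (alpha gamma * gamma)].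
Proof.
move=> g0 g1; have G : 0 < 3 + gamma by lra.
split; rewrite /alpha.
- by rewrite ltr_pdivlMr//; lra.
- by rewrite ltr_pdivrMr//; lra.
- by field; rewrite gt_eqF.
Qed.

(* For [V = (w + tau) ^ (1 / alpha)], supersolutions satisfy
   [V * D V <= C - (alpha - 1) |grad V| ^ 4], where [D] is the infinity
   Laplacian, so steep cones are comparison functions for [V] from below
   whatever the size of [V]. *)
Lemma cone_below (gamma A L tau rho : R) Om w (h : R -> R) (y0 : 'rV[R]_n) :
  0 <= gamma -> gamma < 1 -> open Om ->
  (forall x, Om x -> {for x, continuous w}) -> visc_supersol Om h w ->
  (forall t, 0 <= t -> h t <= 2 * (t + tau) `^ (- gamma)) ->
  ceball y0 rho `<=` Om -> (forall x, ceball y0 rho x -> 0 <= w x) ->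
  0 < tau -> 0 < rho -> 0 < A -> A `^ alpha gamma <= w y0 ->
  A <= L * rho -> 0 < L ->
  2 < alpha gamma ^+ 2 * (alpha gamma - 1) ^+ 2 * L ^+ 4 ->
  forall x, ceball y0 rho x ->
    A - L * enorm (x - y0) <= (w x + tau) `^ (alpha gamma)^-1.
Proof.
move=> g0 g1 oOm cw sw hle subB w0 tau0 rho0 A0 Aw AL L0 bigL x xB.
have [al1 al2 al3] := alpha_exponent g0 g1.
set al := alpha gamma in Aw bigL al1 al2 al3 *.
have alp : 0 < al by lra.
have wt0 y : ceball y0 rho y -> 0 < w y + tau by move=> yB; rewrite ltr_wpDl// w0.
pose V y := (w y + tau) `^ al^-1.
have Val y : ceball y0 rho y -> V y `^ al = w y + tau.
  by move=> yB; rewrite /V -powRrM mulVf ?gt_eqF// powRr1// ltW// wt0.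
pose f y := V y + L * enorm (y - y0).
have cf : {within ceball y0 rho, continuous f}.
  apply: continuous_in_subspaceT => y /set_mem yB.
  apply: continuousD; last first.
    by apply: continuousM; [exact: cst_continuous|exact: continuous_enorm_dist].
  apply: (@continuous_comp _ _ _ (fun y => w y + tau) (@powR R ^~ al^-1)).
    by apply: continuousD; [exact/cw/subB|exact: cst_continuous].
  exact/powR_continuous_gt0/wt0.
have y0B : ceball y0 rho y0 by rewrite /ceball/= subrr enorm0 ltW.
have [x1 x1B x1min] := compact_min_attained (@compact_ceball R n y0 rho) (ex_intro _ _ y0B) cf.
(* If the minimum of [f] is below [A], it is attained neither at the vertex, where V >= A, nor on
   the sphere, where L rho >= A; so the cone can be tested at an interior point other than its
   vertex. *)
suff : A <= f x1.
  by move=> h1; rewrite lerBlDr; apply: le_trans h1 _; exact: x1min.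
rewrite leNgt; apply/negP => fA.
have Vx1 : 0 < V x1 by rewrite powR_gt0// wt0.
have x1y0 : x1 != y0.
  apply/eqP => E; move: fA; rewrite /f E subrr enorm0 mulr0 addr0 ltNge => /negP; apply.
  rewrite -[leLHS]powRr1 ?(ltW A0)// -(divff (lt0r_neq0 alp)) powRrM.
  apply: ge0_ler_powR; rewrite ?nnegrE ?invr_ge0 ?powR_ge0 ?(ltW alp) ?(ltW (wt0 _ y0B))//.
  by rewrite (le_trans Aw)// lerDl ltW.
pose r1 := enorm (x1 - y0).
have r10 : 0 < r1.
  by rewrite lt_def enorm_ge0 andbT; apply: contraNneq x1y0 => /enorm_eq0/eqP; rewrite subr_eq0.
have r1rho : r1 < rho.
  rewrite ltNge; apply/negP => rr; move: fA; rewrite ltNge => /negP; apply.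
  rewrite (le_trans AL)// /f -/r1 (le_trans _ (_ : L * r1 <= _))//.
    by rewrite ler_wpM2l// ltW.
  by rewrite lerDr ltW.
have b01 : 0 < al - 1 < 1 by apply/andP; split; lra.
have [P [P1 Pnear PE]] := cone_test_poly Vx1 r10 b01 (ltW L0).
rewrite (_ : 1 + (al - 1) = al) in P1 Pnear PE; last by ring.
have sq1 : sqdist y0 x1 = r1 ^+ 2 by rewrite sqdistE.
(* Minimality of [x1] says that V y >= V x1 - L (|y - y0| - r1). Raising this to the power alpha
   puts [P] below w + tau, with equality at [x1]. *)
have touch : \forall y \near x1, w x1 - radial (P - tau%:P) y0 x1 <= w y - radial (P - tau%:P) y0 y.
  have nB : \forall y \near x1, ceball y0 rho y.
    have : \forall y \near x1, eball y0 rho y.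
      by apply: open_nbhs_nbhs; split; [exact: open_eball|].
    by apply: filterS => y; exact: ltW.
  have nP : \forall y \near x1, 0 < V x1 - L * (Num.sqrt (sqdist y0 y) - r1) /\
      P.[sqdist y0 y] <= (V x1 - L * (Num.sqrt (sqdist y0 y) - r1)) `^ al.
    have c1 : sqdist y0 y @[y --> x1] --> r1 ^+ 2.
      by rewrite -sq1; exact: continuous_sqdist.
    exact: (c1 _ Pnear).
  near=> y.
  have yB : ceball y0 rho y by near: y.
  have [base Py] : 0 < V x1 - L * (Num.sqrt (sqdist y0 y) - r1) /\
      P.[sqdist y0 y] <= (V x1 - L * (Num.sqrt (sqdist y0 y) - r1)) `^ al by near: y.
  rewrite /radial !hornerD !hornerN !hornerC sq1 P1 Val//.
  have -> : w x1 - (w x1 + tau - tau) = 0 by ring.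
  rewrite subr_ge0 lerBlDr -Val// (le_trans Py)//.
  apply: ge0_ler_powR; rewrite ?nnegrE ?(ltW alp) ?(ltW base) ?powR_ge0//.
  rewrite sqdistE sqrtr_sqr ger0_norm ?enorm_ge0//.
  have := x1min y yB; rewrite /f -/r1; lra.
have := sw _ _ (subB _ x1B) (@Ck2_radial R n (P - tau%:P) y0 Om) touch.
rewrite infty_laplacian_radial/= sq1 derivB derivC subr0 PE.
apply/negP; rewrite -ltNge (le_lt_trans (hle _ (w0 _ x1B)))//.
(* Both sides carry the factor V ^ (3 alpha) / V ^ 4, so only the condition [bigL] on the slope
   remains. *)
rewrite -(Val _ x1B) -powRrM mulrN -al3.
have -> : V x1 `^ (3 * al - 4) = (V x1 `^ al) ^+ 3 / V x1 ^+ 4.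
  rewrite powRB; last by apply/implyP => _; rewrite gt_eqF.
  by rewrite (mulrC 3) powRrM !powR_mulrn ?powR_ge0// ltW.
rewrite mulrC ltr_pM2l//.
by rewrite divr_gt0 ?exprn_gt0// powR_gt0.
Unshelve. all: by end_near. Qed.

End ConeComparison.

Section Penalty.
Context {R : realType}.
Variables (gamma eps : R) (beta : R -> R).
Hypotheses (gamma_ge0 : 0 <= gamma) (gamma_lt1 : gamma < 1) (eps0 : 0 < eps).
Hypothesis cut : cutoff gamma beta.

Lemma delta_gt0 : 0 < delta gamma.
Proof.
have [al1 _ _] := alpha_exponent gamma_ge0 gamma_lt1.
by rewrite /delta mulr_gt0 ?invr_gt0// powR_gt0//; lra.
Qed.

Lemma threshold_gt0 : 0 < delta gamma / 2 * eps `^ alpha gamma.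
Proof. by rewrite mulr_gt0 ?powR_gt0// divr_gt0// delta_gt0. Qed.

Lemma penalty_le0 t : t <= 0 -> penalty gamma beta eps t = 0.
Proof.
by move=> t0; rewrite /penalty (le_trans t0 (ltW threshold_gt0)).
Qed.

(** Where the penalty is nonzero, [t] exceeds the threshold and hence [tau], so t + tau <= 2 t; the
    factor 2 bounds 2 ^ gamma. *)
Lemma penalty_le t tau : 0 <= t -> 0 < tau ->
  tau <= delta gamma / 2 * eps `^ alpha gamma ->
  penalty gamma beta eps t <= 2 * (t + tau) `^ (- gamma).
Proof.
move=> t0 tau0 taule; rewrite /penalty; case: ifPn => [_|].
  by rewrite mulr_ge0 ?powR_ge0.
rewrite -ltNge => lt_t; have tp : 0 < t by exact: lt_trans threshold_gt0 lt_t.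
have [_ /(_ (t / eps `^ alpha gamma))/andP[_ b1] _ _] := cut.
rewrite (le_trans (ler_piMl _ b1)) ?powR_ge0//.
rewrite !powRN -ler_pdivrMl// -invfM lef_pV2 ?posrE ?mulr_gt0 ?powR_gt0//; last lra.
rewrite (@le_trans _ _ ((2 * t) `^ gamma))//.
  by apply: ge0_ler_powR; rewrite ?nnegrE//; lra.
rewrite powRM ?(ltW tp)// ler_wpM2r ?powR_ge0//.
by apply: ler1_powR; [lra|exact: ltW].
Qed.

Lemma penalty_eq t : delta gamma * eps `^ alpha gamma <= t ->
  penalty gamma beta eps t = t `^ (- gamma).
Proof.
move=> tle; have e0 : 0 < eps `^ alpha gamma by rewrite powR_gt0.
have d0 := delta_gt0.
rewrite /penalty ifF; last first.
  apply/negbTE; rewrite -ltNge (lt_le_trans _ tle)// ltr_pM2r//; lra.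
by have [_ _ _ ->] := cut; rewrite ?mul1r// ler_pdivlMr.
Qed.

End Penalty.

(** * Competitors *)

Section Competitors.
Context {R : realType} {n : nat}.
Implicit Types (Om : set 'rV[R]_n) (w ulow uupp : 'rV[R]_n -> R) (h : R -> R).

Lemma within_continuousB (A : set 'rV[R]_n) w (g : 'rV[R]_n -> R) :
  {within A, continuous w} -> continuous g -> {within A, continuous (fun y => w y - g y)}.
Proof.
move=> /subspace_continuousP cw cg; apply/subspace_continuousP => y Ay.
apply: cvgB; first exact: cw.
by apply: cvg_trans (cg y); apply: cvg_app; exact: cvg_within.
Qed.

Definition competitors Om h ulow uupp : set ('rV[R]_n -> R) :=
  [set w | [/\ {within closure Om, continuous w}, visc_supersol Om h w &
    forall y, closure Om y -> ulow y <= w y <= uupp y]].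

Lemma bounded_compact_closure Om : bounded_set Om -> compact (closure Om).
Proof.
move=> [M [Mr HM]]; apply: bounded_closed_compact; last exact: closed_closure.
exists M; split => // N MN x clx /=.
have cN : closed [set y : 'rV[R]_n | `|y| <= N].
  apply: (@preimage_closed _ _ (fun y : 'rV[R]_n => `|y|) [set t | t <= N]).
    by move=> y _; exact: norm_continuous.
  exact: closed_le.
suff : closure Om `<=` [set y : 'rV[R]_n | `|y| <= N] by apply.
rewrite closureE => y; apply; split => // z; exact: HM.
Qed.

(** The barrier [ulow] may dip below 0 inside [Om], so the sign comes from the equation. At an
    interior minimum of w - eta |y - a|^2 with w < 0, the test function has positive infinity
    Laplacian, since [a] is outside [Om], while h <= 0 there. *)
Lemma competitors_ge0 Om h ulow uupp w (a : 'rV[R]_n) :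
  open Om -> compact (closure Om) -> ~ Om a -> (forall t, t <= 0 -> h t <= 0) ->
  (forall x, boundary Om x -> 0 <= ulow x) ->
  competitors Om h ulow uupp w -> forall x, closure Om x -> 0 <= w x.
Proof.
move=> oOm cOm Oma h0 bd [cw sw lu] z clz; rewrite leNgt; apply/negP => wz.
have [y0 _ y0max] : exists2 y0, closure Om y0 &
    forall y, closure Om y -> - sqdist a y0 <= - sqdist a y.
  apply: compact_min_attained => //; first by exists z.
  apply: continuous_subspaceT => y; apply: continuousN.
  exact: continuous_sqdist.
pose M := sqdist a y0.
have M0 : 0 <= M by rewrite /M sqdistE sqr_ge0.
have HM y : closure Om y -> sqdist a y <= M by move=> /y0max; rewrite lerN2.
(* The perturbation stays below - w z on the closure, so [w] is still negative at the perturbed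
   minimum, which excludes the boundary. *)
pose eta := - w z / (2 * (M + 1)).
have eta0 : 0 < eta by rewrite divr_gt0 ?oppr_gt0// mulr_gt0// ltr_wpDl.
have etaM : eta * M < - w z.
  rewrite /eta mulrAC ltr_pdivrMr; last by rewrite mulr_gt0// ltr_wpDl.
  by rewrite ltr_pM2l ?oppr_gt0//; lra.
have [x2 clx2 x2min] : exists2 x2, closure Om x2 & forall y, closure Om y ->
    w x2 - eta * sqdist a x2 <= w y - eta * sqdist a y.
  apply: compact_min_attained => //; first by exists z.
  have := within_continuousB cw (@continuous_radial R n (eta *: 'X) a).
  by under eq_fun do rewrite /radial !hornerE.
have wx2 : w x2 <= w z + eta * M.
  have := x2min _ clz; have : 0 <= eta * sqdist a z by rewrite mulr_ge0 ?(ltW eta0)// sqdistE sqr_ge0.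
  have : eta * sqdist a x2 <= eta * M by rewrite ler_wpM2l ?(ltW eta0)// HM.
  lra.
have Omx2 : Om x2.
  apply: contrapT => nOm.
  have : 0 <= w x2.
    have /andP[+ _] := lu _ clx2; apply: le_trans; apply: bd; split => //.
    by move=> /interior_subset.
  lra.
have touch : \forall y \near x2, w x2 - radial (eta *: 'X) a x2 <= w y - radial (eta *: 'X) a y.
  have : \forall y \near x2, Om y by exact: open_nbhs_nbhs.
  apply: filterS => y Omy; rewrite /radial !hornerE.
  by apply: x2min; exact: subset_closure.
have := sw _ _ Omx2 (@Ck2_radial R n (eta *: 'X) a Om) touch.
rewrite infty_laplacian_radial/= derivZ derivX -mul_polyC mulr1 derivC !hornerC.
apply/negP; rewrite -ltNge (le_lt_trans (h0 _ _))//; first lra.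
have s0 : 0 < sqdist a x2.
  rewrite sqdistE exprn_gt0// lt_def enorm_ge0 andbT; apply: contra_notN Oma => /eqP /enorm_eq0/eqP.
  by rewrite subr_eq0 => /eqP <-.
set X := (X in _ < X).
have -> : X = 8 * (eta ^+ 3 * sqdist a x2) by rewrite /X; ring.
by rewrite mulr_gt0// mulr_gt0// exprn_gt0.
Qed.

Lemma competitors_min Om h ulow uupp w1 w2 : competitors Om h ulow uupp w1 ->
  competitors Om h ulow uupp w2 -> competitors Om h ulow uupp (w1 \min w2).
Proof.
move=> [c1 s1 b1] [c2 s2 b2]; split.
- by move=> x; apply: continuous_min; [exact: c1|exact: c2].
- move=> psi x Omx Cpsi touch.
  have [w12|w21] := leP (w1 x) (w2 x).
    have -> : (w1 \min w2) x = w1 x by exact: min_l.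
    apply: s1 => //; apply: filterS touch => y; rewrite /= (min_l w12).
    by move=> /le_trans; apply; rewrite lerD2r ge_min lexx.
  have -> : (w1 \min w2) x = w2 x by exact/min_r/ltW.
  apply: s2 => //; apply: filterS touch => y; rewrite /= (min_r (ltW w21)).
  by move=> /le_trans; apply; rewrite lerD2r ge_min lexx orbT.
- move=> y cly; have /andP[l1 u1] := b1 y cly; have /andP[l2 u2] := b2 y cly.
  by rewrite /= le_min l1 l2 ge_min u1.
Qed.

(* Dini: the competitors are directed downwards under [min]. *)
Lemma competitors_lt_compact Om h ulow uupp (th : 'rV[R]_n -> R) (K : set 'rV[R]_n) w0 :
  open Om -> compact K -> K `<=` Om -> continuous th ->
  competitors Om h ulow uupp w0 ->
  (forall p, K p -> exists2 w, competitors Om h ulow uupp w & w p < th p) ->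
  exists2 w, competitors Om h ulow uupp w & forall p, K p -> w p < th p.
Proof.
move=> oOm cK KOm cth Cw0 Hp.
have /choice[W HW] (p : 'rV[R]_n) : exists w, competitors Om h ulow uupp w /\
    (K p -> w p < th p).
  have [Kp|nKp] := pselect (K p); first by have [w Cw wp] := Hp p Kp; exists w.
  by exists w0.
pose U p := Om `&` [set y | W p y < th y].
have oU p : open (U p).
  rewrite openE => y [Omy Wy]; apply: filterI; first exact: open_nbhs_nbhs.
  have [[cW _ _] _] := HW p.
  have c1 : {for y, continuous (fun y => W p y - th y)}.
    by apply: continuousB; [exact: within_closure_continuous cW Omy|exact: cth].
  have : \forall z \near y, W p z - th z < 0.
    by move/cvgr_lt : c1; apply; rewrite subr_lt0.
  by apply: filterS => z; rewrite subr_lt0.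
move: cK; rewrite compact_cover => /(_ _ K U (fun p _ => oU p)).
case=> [p Kp|D _ HD].
  by exists p => //; split; [exact: KOm|have [_] := HW p; exact].
have [w Cw wD] : exists2 w, competitors Om h ulow uupp w &
    forall p, p \in (D : seq 'rV[R]_n) -> forall y, w y <= W p y.
  elim: (D : seq _) => [|p s [w Cw IH]]; first by exists w0.
  exists (w \min W p); first by apply: competitors_min => //; have [] := HW p.
  move=> q; rewrite inE => /orP[/eqP ->|qs] y; rewrite /= ge_min ?lexx ?orbT//.
  by rewrite IH.
exists w => // y Ky; have [p pD [_ Wy]] := HD y Ky.
exact: le_lt_trans (wD p pD y) Wy.
Qed.

(** * Gluing a paraboloid into a competitor *)

Section Glue.
Variables (Om : set 'rV[R]_n) (h : R -> R) (ulow uupp w : 'rV[R]_n -> R) (H : R).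
Variables (x0 : 'rV[R]_n) (r s b : R).
Hypotheses (oOm : open Om) (Cw : competitors Om h ulow uupp w).
Hypotheses (clow : {within closure Om, continuous ulow})
  (slow : visc_subsol Om (fun=> H) ulow).
Hypotheses (r0 : 0 < r) (b0 : 0 <= b) (BOm : ceball x0 r `<=` Om).

Definition bowl : 'rV[R]_n -> R := radial (s%:P + b *: 'X) x0.

Lemma bowlE y : bowl y = s + b * enorm (y - x0) ^+ 2.
Proof. by rewrite /bowl /radial hornerD hornerC hornerZ hornerX sqdistE. Qed.

Lemma infty_laplacian_bowl y : infty_laplacian bowl y = 8 * b ^+ 3 * enorm (y - x0) ^+ 2.
Proof.
rewrite infty_laplacian_radial/= derivD derivC add0r derivZ derivX -mul_polyC mulr1.
by rewrite derivC !hornerC sqdistE; ring.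
Qed.

Hypothesis w_sphere : forall p, enorm (p - x0) = r -> w p < bowl p.
Hypothesis lap_h : forall y, ceball x0 r y -> 8 * b ^+ 3 * r ^+ 2 <= h (bowl y).
Hypothesis lap_H : 8 * b ^+ 3 * r ^+ 2 < H.

Definition glued y := if enorm (y - x0) <= r then Num.min (w y) (bowl y) else w y.

Let lap_le y : ceball x0 r y -> infty_laplacian bowl y <= 8 * b ^+ 3 * r ^+ 2.
Proof.
move=> yB; rewrite infty_laplacian_bowl ler_wpM2l ?mulr_ge0 ?exprn_ge0//.
by rewrite ler_pXn2r// nnegrE ?enorm_ge0// ltW.
Qed.

Let near_eball y : enorm (y - x0) < r -> \forall z \near y, eball x0 r z.
Proof. by move=> yr; apply: open_nbhs_nbhs; split; [exact: open_eball|]. Qed.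

Let cbowl : continuous bowl.
Proof. exact: continuous_radial. Qed.

Let glued_le y : glued y <= w y.
Proof. by rewrite /glued; case: ifP => // _; rewrite ge_min lexx. Qed.

(** On the sphere ulow <= w < bowl. Inside, bowl - ulow has no negative minimum, because the bowl
    would be a test function for [ulow] with infinity Laplacian below [H]. *)
Let ulow_le_bowl y : ceball x0 r y -> ulow y <= bowl y.
Proof.
move=> yB.
have [x1 x1B x1min] : exists2 x1, ceball x0 r x1 & forall z, ceball x0 r z ->
    bowl x1 - ulow x1 <= bowl z - ulow z.
  apply: compact_min_attained; [exact: compact_ceball|by exists y|].
  apply: continuous_in_subspaceT => z /set_mem zB.
  apply: continuousB; first exact: cbowl.
  exact: within_closure_continuous clow (BOm zB).
rewrite -subr_ge0 (le_trans _ (x1min _ yB))// leNgt; apply/negP => neg.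
have x1r : enorm (x1 - x0) < r.
  rewrite lt_neqAle x1B andbT; apply/eqP => E.
  have [_ _ /(_ _ (subset_closure (BOm x1B)))/andP[lo _]] := Cw.
  by have := w_sphere E; lra.
have := slow (BOm x1B) (@Ck2_radial R n _ x0 Om) _ => /(_ (s%:P + b *: 'X)).
have touch : \forall z \near x1, ulow z - bowl z <= ulow x1 - bowl x1.
  apply: filterS (near_eball x1r) => z zr.
  by have := x1min z (ltW zr); lra.
move=> /(_ touch); apply/negP; rewrite -ltNge.
exact: le_lt_trans (lap_le x1B) lap_H.
Qed.

(** The strict inequality w < bowl on the sphere makes [glued] equal to [w] near it, so nothing
    breaks across the interface. A test function touching [glued] from below touches [w] where the
    two agree; elsewhere the point is strictly inside the ball and the bowl is compared
    classically. *)
Lemma glued_competitor : competitors Om h ulow uupp glued.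
Proof.
have [cw sw lu] := Cw; split.
- have cmin : {within closure Om, continuous (w \min bowl)}.
    move=> y; apply: continuous_min; first exact: cw.
    by apply: continuous_subspaceT; exact: cbowl.
  apply/subspace_continuousP => y cly.
  have cwy := (iffLR (subspace_continuousP _ w) cw) y cly.
  have [yr|ry] := ltP (enorm (y - x0)) r.
    have E : (w \min bowl) y = glued y by rewrite /glued (ltW yr).
    suff : glued z @[z --> within (closure Om) (nbhs y)] --> (w \min bowl) y by rewrite E.
    apply: cvg_trans ((iffLR (subspace_continuousP _ _) cmin) y cly).
    apply: near_eq_cvg; apply: cvg_within.
    by apply: filterS (near_eball yr) => z zr; rewrite /glued (ltW zr).
  have E : w y = glued y.
    rewrite /glued; case: ifPn => // yr; rewrite min_l// ltW// w_sphere//.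
    by apply/eqP; rewrite eq_le yr ry.
  suff : glued z @[z --> within (closure Om) (nbhs y)] --> w y by rewrite E.
  apply: (cvg_trans _ cwy); apply: near_eq_cvg.
  have [yr|yr] := eqVneq (enorm (y - x0)) r.
    have c1 : w z - bowl z @[z --> within (closure Om) (nbhs y)] --> w y - bowl y.
      have cb : bowl z @[z --> within (closure Om) (nbhs y)] --> bowl y.
        exact: cvg_trans (cvg_app bowl (@cvg_within _ (nbhs y) _ (closure Om))) (@cbowl y).
      exact: cvgB cwy cb.
    have : \forall z \near within (closure Om) (nbhs y), w z - bowl z < 0.
      by move/cvgr_lt : c1; apply; rewrite subr_lt0 w_sphere.
    apply: filterS => z; rewrite subr_lt0 => wz.
    by rewrite /glued; case: ifP => // _; rewrite min_l// ltW.
  apply: cvg_within.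
  have : \forall z \near y, r < enorm (z - x0).
    have /cvgr_gt := @continuous_enorm_dist R n x0 y; apply.
    by rewrite lt_neqAle eq_sym yr.
  by apply: filterS => z zr; rewrite /glued leNgt zr.
- move=> psi x Omx Cpsi touch.
  have [Ew|nEw] := eqVneq (glued x) (w x).
    rewrite Ew; apply: sw => //; apply: filterS touch => y; rewrite Ew.
    by move=> /le_trans; apply; rewrite lerD2r.
  have [xr Eb] : enorm (x - x0) < r /\ glued x = bowl x.
    move: nEw; rewrite /glued; case: ifPn; last by rewrite eqxx.
    move=> xr; have [|bw _] := leP (w x) (bowl x); first by rewrite eqxx.
    split => //; rewrite lt_neqAle xr andbT; apply/eqP => /w_sphere.
    by rewrite ltNge (ltW bw).
  have xB : ceball x0 r x by exact: ltW.
  rewrite Eb; apply: le_trans (lap_h xB); apply: le_trans (lap_le xB).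
  apply: (infty_laplacian_le_at_max oOm Omx Cpsi); first exact: Ck2_radial.
  have := touch; rewrite -/(bowl) Eb => t1.
  near=> y.
  have yr : enorm (y - x0) < r by near: y; exact: near_eball.
  have gy : glued y <= bowl y by rewrite /glued (ltW yr) ge_min lexx orbT.
  have : bowl x - psi x <= glued y - psi y by near: y.
  rewrite -/(bowl y) -/(bowl x); lra.
- move=> y cly; have /andP[lo up] := lu y cly.
  rewrite (le_trans (glued_le y) up) andbT /glued; case: ifPn => // yB.
  by rewrite le_min lo ulow_le_bowl.
Unshelve. all: by end_near. Qed.

End Glue.

End Competitors.

(** * Minimal solutions *)

Section MinimalSolutions.
Context {R : realType} {n : nat}.
Variables (gamma eps : R) (beta : R -> R).
Hypotheses (gamma_ge0 : 0 <= gamma) (gamma_lt1 : gamma < 1) (eps0 : 0 < eps).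
Hypothesis cut : cutoff gamma beta.
Variables (Om : set 'rV[R]_n) (phi v : 'rV[R]_n -> R).
Hypotheses (oOm : open Om) (msol : minimal_solution Om gamma beta phi eps v).

Let al := alpha gamma.

Lemma powRN_anti (p x y : R) : 0 <= p -> 0 < x -> x <= y -> y `^ (- p) <= x `^ (- p).
Proof.
move=> p0 x0 xy; have y0 : 0 < y by exact: lt_le_trans xy.
rewrite !powRN lef_pV2 ?posrE ?powR_gt0//.
by apply: ge0_ler_powR; rewrite ?nnegrE// ltW.
Qed.

(* If [v] were small on the sphere, a bowl of height [delta * eps ^ alpha] at the
   center could be glued into a competitor. *)
Lemma minimal_solution_nondegenerate (x0 : 'rV[R]_n) (r : R) :
  0 < r -> ceball x0 r `<=` Om -> delta gamma * eps `^ al <= r `^ al / 4 ->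
  delta gamma * eps `^ al < v x0 ->
  exists2 p, enorm (p - x0) = r & r `^ al / 4 <= v p.
Proof.
move=> r0 BOm sr sv.
have [al1 al2 al3] := alpha_exponent gamma_ge0 gamma_lt1.
rewrite -/al in al1 al2 al3.
have [ulow [uupp [[clow slow _ _] _ vE]]] := msol.
pose C := competitors Om (penalty gamma beta eps) ulow uupp.
have {}vE x : closure Om x -> v x = inf [set w x | w in C] by move=> /vE.
have clB y : ceball x0 r y -> closure Om y by move=> /BOm; exact: subset_closure.
set s := delta gamma * eps `^ al in sr sv.
have s0 : 0 < s by rewrite mulr_gt0 ?powR_gt0// delta_gt0.
have x0B : ceball x0 r x0 by rewrite /ceball/= subrr enorm0 ltW.
(* The infimum of the empty set is 0, which v x0 > s > 0 excludes. *)
have [w0 Cw0] : exists w, C w.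
  apply: contrapT => nC; move: sv; rewrite vE; last exact: clB.
  rewrite (_ : [set _ | _ in _] = set0) ?inf0; first by rewrite ltNge (ltW s0).
  by apply/seteqP; split => // t [w Cw _]; case: nC; exists w.
apply: contrapT => np.
have vsphere p : enorm (p - x0) = r -> v p < r `^ al / 4.
  by move=> pr; rewrite ltNge; apply/negP => vp; apply: np; exists p.
(* Then b r^2 = r ^ alpha / 4, the level assumed on the sphere, and 8 b^3 r^2 = r ^ (- alpha gamma)
   / 8 by the scaling law. The height [s] makes the inequality v < bowl on the sphere strict. *)
pose b := r `^ (al - 2) / 4.
have b0 : 0 < b by rewrite divr_gt0// powR_gt0.
have ral0 : 0 < r `^ al by rewrite powR_gt0.
have br2 : b * r ^+ 2 = r `^ al / 4.
  rewrite /b powRB; last by apply/implyP => _; rewrite gt_eqF.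
  by rewrite powR_mulrn ?(ltW r0)//; field; rewrite gt_eqF.
have mE : 8 * b ^+ 3 * r ^+ 2 = (r `^ al) `^ (- gamma) / 8.
  rewrite -powRrM mulrN -al3 powRB; last by apply/implyP => _; rewrite gt_eqF.
  rewrite (mulrC 3) powRrM !powR_mulrn ?powR_ge0 ?(ltW r0)//.
  rewrite /b powRB; last by apply/implyP => _; rewrite gt_eqF.
  by rewrite powR_mulrn ?(ltW r0)//; field; rewrite gt_eqF.
have m0 : 0 < (r `^ al) `^ (- gamma) by rewrite powR_gt0.
pose K := [set p : 'rV[R]_n | enorm (p - x0) = r].
have cK : compact K.
  apply: (subclosed_compact _ (@compact_ceball R n x0 r)).
    apply: (@preimage_closed _ _ (fun y : 'rV[R]_n => enorm (y - x0)) [set t | t = r]).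
      by move=> y _; exact: continuous_enorm_dist.
    exact: closed_eq.
  by move=> p; rewrite /K/ceball/= => ->.
have KB : K `<=` ceball x0 r by move=> p; rewrite /K/ceball/= => ->.
have [w Cw wK] : exists2 w, C w & forall p, K p -> w p < bowl x0 s b p.
  apply: (competitors_lt_compact oOm cK _ (@continuous_radial R n _ x0) Cw0).
    exact: subset_trans KB BOm.
  move=> p Kp; have : inf [set w p | w in C] < bowl x0 s b p.
    rewrite -vE; last exact/clB/KB.
    by rewrite bowlE Kp br2 (lt_le_trans (vsphere _ Kp))// lerDr ltW.
  move=> /inf_lt[|_ [w Cw <-] wp]; first by exists (w0 p), w0.
  by exists w.
have bowl_le y : ceball x0 r y -> bowl x0 s b y <= r `^ al.
  move=> yB; rewrite bowlE.
  have : b * enorm (y - x0) ^+ 2 <= b * r ^+ 2.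
    by rewrite ler_wpM2l ?(ltW b0)// ler_pXn2r// nnegrE ?enorm_ge0// ltW.
  by rewrite br2; lra.
have bowl_ge y : s <= bowl x0 s b y.
  by rewrite bowlE lerDl mulr_ge0 ?(ltW b0)// exprn_ge0// enorm_ge0.
have := @glued_competitor R n Om (penalty gamma beta eps) ulow uupp w
  ((delta gamma / 2) `^ (- gamma) * eps `^ (- (alpha gamma * gamma)))
  x0 r s b oOm Cw clow slow r0 (ltW b0) BOm wK.
have lap_h y : ceball x0 r y -> 8 * b ^+ 3 * r ^+ 2 <= penalty gamma beta eps (bowl x0 s b y).
  move=> yB; rewrite (penalty_eq gamma_ge0 gamma_lt1 eps0 cut (bowl_ge y)).
  rewrite mE (@le_trans _ _ ((r `^ al) `^ (- gamma)))//; first lra.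
  by apply: powRN_anti => //; [exact: lt_le_trans s0 (bowl_ge y)|exact: bowl_le].
(* The right-hand side of the equation for [ulow] is the power - gamma of s / 2, and s / 2 <= r ^
   alpha. *)
have lap_H : 8 * b ^+ 3 * r ^+ 2 <
    (delta gamma / 2) `^ (- gamma) * eps `^ (- (alpha gamma * gamma)).
  rewrite -mulrN powRrM -powRM ?powR_ge0//; last by rewrite divr_ge0// ltW// delta_gt0.
  rewrite mE (@lt_le_trans _ _ ((r `^ al) `^ (- gamma)))//; first lra.
  apply: powRN_anti => //; first exact: threshold_gt0.
  by rewrite mulrAC -/al -/s; lra.
move=> /(_ lap_h lap_H) Cg.
have : v x0 <= s.
  rewrite vE; last exact: clB.
  apply: (@le_trans _ _ (glued w x0 r s b x0)).
    apply: ge_inf; last by exists (glued w x0 r s b).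
    by exists (ulow x0) => _ [w' [_ _ lu] <-]; have /andP[] := lu _ (clB _ x0B).
  rewrite /glued subrr enorm0 (ltW r0) ge_min bowlE subrr enorm0.
  by rewrite expr0n mulr0 addr0 lexx orbT.
by rewrite leNgt sv.
Qed.

(** The slope [L] and the height [A] are common to all competitors, so their cone bounds survive the
    infimum. The resulting lower bound does not involve [eps], which is what the passage to the
    limit requires. *)
Lemma minimal_solution_cone (a y0 : 'rV[R]_n) (A L rho : R) :
  compact (closure Om) -> ~ Om a -> (forall x, boundary Om x -> 0 <= phi x) ->
  ceball y0 rho `<=` Om -> 0 < rho -> 0 < A -> A `^ al <= v y0 ->
  A <= L * rho -> 0 < L -> 2 < al ^+ 2 * (al - 1) ^+ 2 * L ^+ 4 ->
  forall x, ceball y0 rho x -> 0 < A - L * enorm (x - y0) ->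
    (A - L * enorm (x - y0)) `^ al / 2 <= v x.
Proof.
move=> cOm Oma phi0 BOm rho0 A0 Av AL L0 bigL x xB pos.
have [al1 al2 al3] := alpha_exponent gamma_ge0 gamma_lt1.
rewrite -/al in al1 al2 al3.
have alp : 0 < al by lra.
have [ulow [uupp [[clow _ _ elow] _ vE]]] := msol.
pose C := competitors Om (penalty gamma beta eps) ulow uupp.
have {}vE z : closure Om z -> v z = inf [set w z | w in C] by move=> /vE.
have clB y : ceball y0 rho y -> closure Om y by move=> /BOm; exact: subset_closure.
have y0B : ceball y0 rho y0 by rewrite /ceball/= subrr enorm0 ltW.
have [w0 Cw0] : exists w, C w.
  apply: contrapT => nC; move: Av; rewrite vE; last exact: clB.
  rewrite (_ : [set _ | _ in _] = set0) ?inf0; first by rewrite leNgt powR_gt0.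
  by apply/seteqP; split => // t [w Cw _]; case: nC; exists w.
rewrite vE; last exact: clB.
apply: lb_le_inf; first by exists (w0 x), w0.
move=> _ [w Cw <-]; have [cw sw lu] := Cw.
have w_ge0 : forall z, closure Om z -> 0 <= w z.
  apply: (competitors_ge0 oOm cOm Oma _ _ Cw) => [t t0|z bz].
    by rewrite penalty_le0.
  by rewrite elow// phi0.
set D := A - _ in pos *.
(* The first entry is what [penalty_le] requires; the second ensures D ^ alpha - tau >= D ^ alpha /
   2. *)
pose tau := Num.min (delta gamma / 2 * eps `^ al) (D `^ al / 2).
have tau0 : 0 < tau by rewrite lt_min threshold_gt0//= divr_gt0// powR_gt0.
have Aw : A `^ al <= w y0.
  rewrite (le_trans Av)// vE; last exact: clB.
  apply: ge_inf; last by exists w.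
  by exists (ulow y0) => _ [w' [_ _ lu'] <-]; have /andP[] := lu' _ (clB _ y0B).
have := @cone_below R n gamma A L tau rho Om w (penalty gamma beta eps) y0
  gamma_ge0 gamma_lt1 oOm (fun x Omx => within_closure_continuous oOm cw Omx) sw.
have hle t : 0 <= t -> penalty gamma beta eps t <= 2 * (t + tau) `^ (- gamma).
  by move=> t0; apply: penalty_le => //; rewrite ge_min lexx.
move=> /(_ hle BOm (fun z zB => w_ge0 z (clB z zB)) tau0 rho0 A0 Aw AL L0 bigL x xB).
rewrite -/D => Dle.
have wx0 : 0 <= w x + tau by apply: addr_ge0; [exact: (w_ge0 _ (clB _ xB))|exact: ltW].
have : D `^ al <= w x + tau.
  have -> : w x + tau = ((w x + tau) `^ al^-1) `^ al.
    by rewrite -powRrM mulVf ?lt0r_neq0// powRr1.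
  by apply: ge0_ler_powR; rewrite ?nnegrE ?powR_ge0 ?(ltW alp) ?(ltW pos).
have : tau <= D `^ al / 2 by rewrite ge_min lexx orbT.
lra.
Qed.

End MinimalSolutions.

(** * Limits of minimal solutions *)

Section LimitSolutions.
Context {R : realType} {n : nat}.
Implicit Types (Om : set 'rV[R]_n).

Lemma uniform_cvg_dist (K : set 'rV[R]_n) (v : nat -> 'rV[R]_n -> R) u (e : R) :
  {uniform K, v @ \oo --> u} -> 0 < e ->
  \forall k \near \oo, forall y, K y -> `|u y - v k y| < e.
Proof.
move=> vu e0; apply: (vu [set g | forall y, K y -> `|u y - g y| < e]).
apply/uniform_nbhs; exists [set xy | ball xy.1 e xy.2]; split => //.
exact: (@entourage_ball R R (PosNum e0)).
Qed.

Lemma eball_sub_of_setdist Om (Om' : set 'rV[R]_n) x (k : R) : open Om -> Om x -> Om' x ->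
  0 < k < setdist Om' (boundary Om) -> eball x k `<=` Om /\ exists a, ~ Om a.
Proof.
move=> oOm Omx Om'x /andP[k0 kd].
have lb : has_lbound [set r | exists x y, [/\ Om' x, boundary Om y & r = enorm (x - y)]].
  by exists 0 => _ [y [z [_ _ ->]]]; exact: enorm_ge0.
split.
  apply: eball_sub_open => // z bz; rewrite (le_trans (ltW kd))//.
  by apply: ge_inf => //; exists x, z.
(* If [Om] were the whole space, its boundary would be empty and [setdist] would be the infimum of
   the empty set, namely 0, contradicting 0 < k. *)
apply: contrapT => nO; move: kd; rewrite /setdist (_ : [set _ | _] = set0).
  by rewrite inf0 ltNge (ltW k0).
apply/seteqP; split => // t [y [z [_ [_ bz] _]]]; case: nO.
exists z => Omz; apply: bz; exact: (open_nbhs_nbhs (conj oOm Omz)).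
Qed.

(** With c = al (al - 1) < 2, the slope 2 / c turns the critical quantity into 16 / c^2 > 4. It
    blows up as al tends to 1, that is as gamma tends to 1. *)
Lemma cone_slope_bound (al : R) : 1 < al -> al < 2 ->
  2 < al ^+ 2 * (al - 1) ^+ 2 * (2 / (al * (al - 1))) ^+ 4 /\ 1 <= 2 / (al * (al - 1)).
Proof.
move=> al1 al2; set c := al * (al - 1).
have c0 : 0 < c by rewrite mulr_gt0//; lra.
have c2 : c < 2 by rewrite /c; nra.
split; last by rewrite ler_pdivlMr// mul1r ltW.
have -> : al ^+ 2 * (al - 1) ^+ 2 * (2 / c) ^+ 4 = 16 / c ^+ 2.
  have -> : al ^+ 2 * (al - 1) ^+ 2 = c ^+ 2 by rewrite /c; ring.
  by field; rewrite gt_eqF.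
rewrite ltr_pdivlMr ?exprn_gt0//; nra.
Qed.

Lemma limit_perron_positive_ball (gamma : R) Om phi beta u x (k : R) (a : 'rV[R]_n) :
  0 <= gamma -> gamma < 1 -> open Om -> bounded_set Om -> ~ Om a ->
  (forall x, boundary Om x -> 0 <= phi x) -> cutoff gamma beta ->
  limit_perron_solution Om gamma beta phi u ->
  0 < k -> eball x k `<=` Om -> 0 < u x ->
  exists p, eball p (k / (32 * (2 / (alpha gamma * (alpha gamma - 1))))) `<=`
    eball x k `&` positivity_set Om u.
Proof.
move=> g0 g1 oOm bOm Oma phi0 cut [eps [v [eps0 epsc vsol vu]]] k0 kOm ux.
have [al1 al2 al3] := alpha_exponent g0 g1.
have [bigL L1] := cone_slope_bound al1 al2.
set al := alpha gamma in al1 al2 al3 bigL L1 *.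
set L := 2 / (al * (al - 1)) in bigL L1 *.
have L0 : 0 < L by lra.
have alp : 0 < al by lra.
have d0 := delta_gt0 g0 g1.
pose r := k / 2; have r0 : 0 < r by rewrite divr_gt0.
have ral : 0 < r `^ al by rewrite powR_gt0.
have Omx : Om x by apply: kOm; rewrite /eball/= subrr enorm0.
have vcvg y (e : R) : Om y -> 0 < e -> \forall j \near \oo, `|u y - v j y| < e.
  move=> Omy e0.
  have sub : [set y] `<=` Om by move=> _ ->.
  have := uniform_cvg_dist (vu [set y] (@compact_set1 _ y) sub) e0.
  by apply: filterS => j; apply.
have small (e : R) : 0 < e -> \forall j \near \oo, delta gamma * eps j `^ al < e.
  (* [t] solves delta t ^ alpha = e. *)
  move=> e0; pose t := (e / delta gamma) `^ al^-1.
  have ed0 : 0 < e / delta gamma by rewrite divr_gt0.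
  have t0 : 0 < t by rewrite powR_gt0.
  have : \forall j \near \oo, eps j < t by move/cvgr_lt : epsc; apply.
  apply: filterS => j et.
  rewrite mulrC -ltr_pdivlMr// (_ : e / _ = t `^ al); last first.
    by rewrite /t -powRrM mulVf ?gt_eqF// powRr1// ltW.
  by apply: gt0_ltr_powR; rewrite ?nnegrE ?(ltW t0) ?(ltW (eps0 j)).
have BOm : ceball x r `<=` Om.
  by move=> y yr; apply: kOm; apply: le_lt_trans yr _; rewrite /r; lra.
have [p pr up] : exists2 p, enorm (p - x) = r & r `^ al / 8 <= u p.
  have e1 : 0 < r `^ al / 8 by rewrite divr_gt0.
  have ux2 : 0 < u x / 2 by rewrite divr_gt0.
  have e2 : 0 < r `^ al / 4 by rewrite divr_gt0.
  have [j [[unif vx] [s1 s2]]] : exists j, ((forall y, ceball x r y -> `|u y - v j y| < r `^ al / 8) /\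
      `|u x - v j x| < u x / 2) /\
      (delta gamma * eps j `^ al < u x / 2 /\ delta gamma * eps j `^ al < r `^ al / 4).
    apply: (@filter_ex _ \oo); apply: filterI; apply: filterI.
    - exact: uniform_cvg_dist (vu _ (@compact_ceball R n x r) BOm) e1.
    - exact: vcvg.
    - exact: small.
    - exact: small.
  have sv : delta gamma * eps j `^ alpha gamma < v j x.
    by move: vx; rewrite ltr_norml => /andP[_ h]; apply: lt_trans s1 _; lra.
  have [p pr vp] := minimal_solution_nondegenerate g0 g1 (eps0 j) cut oOm (vsol j)
      r0 BOm (ltW s2) sv.
  exists p => //; have /unif : ceball x r p by rewrite /ceball/= pr.
  by rewrite ltr_norml => /andP[h _]; rewrite -/al in vp; lra.
have px z : eball p (k / 4) z -> eball x k z.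
  move=> zp; have := ler_enorm_dist p z x; rewrite pr => h.
  by apply: le_lt_trans h _; move: zp; rewrite /eball/= /r; lra.
exists p => z zp.
(* The cone has height A = r / 16, so A ^ alpha <= r ^ alpha / 16 since alpha > 1, strictly below
   the value of [u] at [p]; that gap lets [v j] reach A ^ alpha at [p]. The radius k / 8 keeps the
   cone inside the ball about [x], and L >= 1 puts its positive part within that radius. *)
pose A := k / 32; have A0 : 0 < A by rewrite divr_gt0.
pose rho := k / 8; have rho0 : 0 < rho by rewrite divr_gt0.
have AL : A <= L * rho by rewrite /A /rho; nra.
have LA : L * enorm (z - p) < A.
  move: zp; rewrite /eball/= invfM mulrA ltr_pdivlMr// => zp.
  by rewrite mulrC.
have zrho : ceball p rho z.
  rewrite /ceball/=; have := enorm_ge0 (z - p); move: LA; rewrite /A /rho; nra.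
have Bp : ceball p rho `<=` Om.
  by move=> y yp; apply/kOm/px; apply: le_lt_trans yp _; rewrite /rho; lra.
have kz : eball x k z by apply: px; apply: le_lt_trans zrho _; rewrite /rho; lra.
have pos : 0 < A - L * enorm (z - p) by rewrite subr_gt0.
split => //; split; first exact: kOm.
have Aal : A `^ al < r `^ al / 8.
  rewrite (_ : A = r * (16)^-1); last by rewrite /A /r; field.
  rewrite powRM ?(ltW r0)//.
  rewrite (@le_lt_trans _ _ (r `^ al * 16^-1))//; last lra.
  rewrite ler_wpM2l ?powR_ge0//; apply: ge1r_powR; last exact: ltW.
  by apply/andP; split; lra.
(* [c] bounds [v j z] from below for every [j] with v j p >= A ^ alpha, so closeness within [c]
   makes [u z] positive. *)
pose c := (A - L * enorm (z - p)) `^ al / 2.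
have c0 : 0 < c by rewrite divr_gt0// powR_gt0.
have e0 : 0 < u p - A `^ al by rewrite subr_gt0 (lt_le_trans Aal).
have Omp : Om p by apply: Bp; rewrite /ceball/= subrr enorm0 ltW.
have [j [vp vz]] : exists j, `|u p - v j p| < u p - A `^ al /\ `|u z - v j z| < c.
  apply: (@filter_ex _ \oo); apply: filterI; first exact: vcvg.
  by apply: vcvg => //; exact: kOm.
have Av : A `^ al <= v j p by move: vp; rewrite ltr_norml => /andP[_ h]; lra.
have := minimal_solution_cone g0 g1 (eps0 j) cut oOm (vsol j)
  (bounded_compact_closure bOm) Oma phi0 Bp rho0 A0 Av AL L0 bigL zrho pos.
rewrite -/al -/c => cv; move: vz; rewrite ltr_norml => /andP[h _]; rewrite /=; lra.
Qed.

End LimitSolutions.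

Theorem corollary1 (R : realType) (n : nat) (gamma : R) (M : \bar R) (d : R) :
  (0 < n)%N -> 0 <= gamma -> gamma < 1 ->
  exists2 cstar : R, 0 < cstar &
    forall (Om : set 'rV[R]_n) (phi : 'rV[R]_n -> R) (beta : R -> R)
           (u : 'rV[R]_n -> R) (Om' : set 'rV[R]_n),
      domain Om -> bounded_set Om -> smooth_boundary Om ->
      smooth phi -> (forall x, boundary Om x -> 0 <= phi x) ->
      cutoff gamma beta ->
      limit_perron_solution Om gamma beta phi u ->
      domain Om' -> compactly_contained Om' Om ->
      Linfty_norm Om u = M -> setdist Om' (boundary Om) = d ->
      forall (x : 'rV[R]_n) (kappa : R),
        (Om' `&` positivity_set Om u) x -> 0 < kappa < d ->
        (cstar%:E <= lebesgue_n (eball x kappa `&` positivity_set Om u)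
                     / lebesgue_n (eball x kappa))%E.
Proof.
move=> n0 g0 g1.
have nR0 : 0 < n%:R :> R by rewrite ltr0n.
have [al1 al2 _] := alpha_exponent g0 g1.
have [_ L1] := cone_slope_bound al1 al2.
set L := 2 / _ in L1.
have L0 : 0 < L by lra.
(* The ball of radius kappa / (32 L) in the positivity set contains a cube of side kappa / (32 L n),
   to be compared with a box of side 2 kappa around the ball of radius kappa. *)
exists ((64 * L * n%:R)^-1 ^+ n).
  by rewrite exprn_gt0// invr_gt0 mulr_gt0// mulr_gt0.
move=> Om phi beta u Om' [oOm _ _] bOm _ _ phi0 cut lim _ _ _ dE x k [Om'x [Omx ux]] kd.
have k0 : 0 < k by case/andP: kd.
rewrite -dE in kd.
have [kOm [a Oma]] := eball_sub_of_setdist oOm Omx Om'x kd.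
have [p pk] := limit_perron_positive_ball g0 g1 oOm bOm Oma phi0 cut lim k0 kOm ux.
rewrite -/L in pk.
have r0 : 0 < k / (32 * L) by rewrite divr_gt0// mulr_gt0.
have := lebesgue_n_density n0 r0 k0 pk (@subIsetl _ _ _).
rewrite (_ : k / (32 * L) / (2 * k * n%:R) = (64 * L * n%:R)^-1)//.
by field; rewrite !gt_eqF.
Qed.
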